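(* (1) If $p_1,p_2,p_3$ is a strongly regular triple, then any triple obtained from it by a bending involving $p_1,p_2$, or by a bending involving $p_2,p_3$, is strongly regular. (2) Let $\alpha,\beta\in\mathbb R$ and $\sigma_1,\sigma_2,\sigma_3\in\{-1,1\}$ be fixed. If $p=(p_1,p_2,p_3)$ and $p'=(p_1',p_2',p_3')$ are strongly regular triples with $\sigma p_j=\sigma p_j'=\sigma_j$ for $j=1,2,3$, $\alpha(p_1,p_2,p_3)=\alpha(p_1',p_2',p_3')=\alpha$ and $\beta(p_1,p_2,p_3)=\beta(p_1',p_2',p_3')=\beta$, then there is a finite sequence of bendings, each involving either the first two or the last two points of the current triple, that transforms $p$ into a triple of the form $(gp_1',gp_2',gp_3')$ with $g\in\mathrm{PU}\,V$.
   Context: $V$ is a $3$-dimensional $\mathbb C$-linear space with a hermitian form $\langle-,-\rangle$ (linear in the first argument) of signature $++-$. Elements of $V$ may denote points of $\mathbb P_{\mathbb C}V$. A point $p$ is negative, isotropic, positive if $\langle p,p\rangle<0$, $=0$, $>0$; $\mathrm SV$ denotes the set of isotropic points and $\sigma p\in\{-1,0,1\}$ the sign of $p$. $\mathrm{PU}\,V$ is the projective unitary group of the form. A geodesic is the image in $\mathbb P_{\mathbb C}V$ of $W\setminus\{0\}$, where $W\subset V$ is a $2$-dimensional real subspace on which the form is real-valued and not identically zero; for distinct nonorthogonal $p_1,p_2$, the geodesic $\mathrm G{\wr}p_1,p_2{\wr}$ is given by $W=\mathbb Rp_1+\mathbb R\langle p_1,p_2\rangle p_2$. A real plane is the image in $\mathbb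 P_{\mathbb C}V$ of $W\setminus\{0\}$, where $W\subset V$ is a $3$-dimensional real subspace spanning $V$ over $\mathbb C$ on which the form is real-valued. A triple of points $p_1,p_2,p_3\in\mathbb P_{\mathbb C}V\setminus\mathrm SV$ is regular if $p_1,p_2,p_3$ are not in a same geodesic, $p_2$ is not orthogonal to $p_1$ nor to $p_3$, and at most one of $p_1,p_2,p_3$ is positive. A regular triple is strongly regular if $p_1,p_2,p_3$ are not in a same projective line and are all negative whenever they belong to a same real plane. With $g_{jk}:=\langle p_j,p_k\rangle$, put $\alpha(p_1,p_2,p_3):=\operatorname{Im}\frac{g_{12}g_{23}g_{31}}{g_{11}g_{22}g_{33}}$ and $\beta(p_1,p_2,p_3):=\frac{\det[g_{jk}]}{g_{11}g_{22}g_{33}}$. Bendings. Let $p_1,p_2$ be distinct nonorthogonal nonisotropic points whose projective line is hyperbolic (signature $+-$; automatic for $p_1,p_2$ and for $p_2,p_3$ in a strongly regular triple). Let $v_1,v_2$ be representatives of the two isotropic points of $\mathrm G{\wr}p_1,p_2{\wr}$ such that $\langle v_1,v_2\rangle=\frac12$, $p_1=v_1+\sigma_1v_2$, $p_2=e^{-a}v_1+\sigma_2e^av_2$ with $0\ne a\in\mathbb R$, $\sigma_j:=\sigma p_j$. The bending involving $p_1,p_2$ is the one-parameter subgroup $B:(\mathbb R,+)\to\mathrm{SU}\,V$ with $B(s)v_1=e^{-as}v_1$, $B(s)v_2=e^{as}v_2$, and $B(s)$ the identity on the orthogonal complement of $\mathbb Cv_1+\mathbb Cv_2$. Bending a triple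 $(p_1,p_2,p_3)$ along $p_1,p_2$ means replacing it by $(B(s)p_1,B(s)p_2,p_3)$ for some $s\in\mathbb R$; bending along $p_2,p_3$ means replacing it by $(p_1,B'(s)p_2,B'(s)p_3)$, where $B'$ is the bending involving $p_2,p_3$. *)

(* Defs.v *)
(* The field of complex numbers is R[i] for R : realType. *)
From HB Require Import structures.
From mathcomp Require Import all_boot all_order all_algebra.
From mathcomp Require Import sesquilinear complex.
From mathcomp Require Import all_classical all_reals all_analysis.
From Stdlib Require Import Relation_Operators.

Set Implicit Arguments.
Unset Strict Implicit.
Unset Printing Implicit Defensive.

Import Order.TTheory GRing.Theory Num.Theory.

Local Open Scope classical_set_scope.
Local Open Scope ring_scope.
Local Open Scope complex_scope.

Section HermitianProjectivePlane.
Variables (R : realType) (V : vectType R[i]).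
Variable h : {hermitian_sym V for Num.conj}.

(* The signature of h on the subspace U is s: U has an h-orthogonal basis e
   for which the signs of the real numbers h e_i e_i are the entries of s. *)
Definition has_signature (U : {vspace V}) (s : seq int) : Prop :=
  exists e : (size s).-tuple V,
    [/\ basis_of U e,
        forall i j : 'I_(size s), i != j -> h e`_i e`_j = 0
      & forall i : 'I_(size s), sgz (h e`_i e`_i) = s`_i].

(* A point of the complex projective space of V is a line of V, and [rep p] is
   a chosen nonzero vector on it. The expressions built on [rep] below do not
   depend on that choice. *)
Definition is_point (p : {vspace V}) : Prop := \dim p = 1%N.
Definition rep (p : {vspace V}) : V := vpick p.

Definition herm (p q : {vspace V}) : R[i] := h (rep p) (rep q).

Definition sigma (p : {vspace V}) : int := sgz (herm p p).
Definition negative (p : {vspace V}) : bool := herm p p < 0.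
Definition isotropic (p : {vspace V}) : bool := herm p p == 0.
Definition positive (p : {vspace V}) : bool := 0 < herm p p.
Definition orthogonal_points (p q : {vspace V}) : bool := herm p q == 0.

(* Real subspaces of V, with scalars restricted to R. *)
Definition real_span n (w : n.-tuple V) : set V :=
  [set v | exists x : 'I_n -> R, v = \sum_(i < n) (x i)%:C *: w`_i].
Definition real_free n (w : n.-tuple V) : Prop :=
  forall x : 'I_n -> R, \sum_(i < n) (x i)%:C *: w`_i = 0 -> forall i, x i = 0.
Definition real_subspace (n : nat) (W : set V) : Prop :=
  exists2 w : n.-tuple V, real_free w & W = real_span w.

Definition real_valued (W : set V) : Prop :=
  forall u v, W u -> W v -> h u v \is Num.real.

Definition proj_image (W : set V) : set {vspace V} :=
  [set <[w]>%VS | w in W `\ 0].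

Definition is_geodesic (G : set {vspace V}) : Prop :=
  exists W : set V,
    [/\ real_subspace 2 W, real_valued W,
        exists u v, [/\ W u, W v & h u v != 0] & G = proj_image W].

Definition geodesic (p1 p2 : {vspace V}) : set {vspace V} :=
  proj_image (real_span [tuple rep p1; herm p1 p2 *: rep p2]).

Definition is_real_plane (P : set {vspace V}) : Prop :=
  exists W : set V,
    [/\ real_subspace 3 W,
        forall U : {vspace V}, (forall w, W w -> w \in U) -> U = fullv,
        real_valued W & P = proj_image W].

Definition regular (p1 p2 p3 : {vspace V}) : Prop :=
  [/\ [/\ is_point p1, is_point p2 & is_point p3],
      [/\ ~~ isotropic p1, ~~ isotropic p2 & ~~ isotropic p3],
      ~ (exists G, [/\ is_geodesic G, G p1, G p2 & G p3]),
      ~~ orthogonal_points p2 p1 /\ ~~ orthogonal_points p2 p3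
    & (count positive [:: p1; p2; p3] <= 1)%N].

Definition strongly_regular (p1 p2 p3 : {vspace V}) : Prop :=
  [/\ regular p1 p2 p3,
      ~ (exists L : {vspace V},
           [/\ \dim L = 2%N, (p1 <= L)%VS, (p2 <= L)%VS & (p3 <= L)%VS])
    & (exists P, [/\ is_real_plane P, P p1, P p2 & P p3]) ->
      [/\ negative p1, negative p2 & negative p3]].

Definition alpha (p1 p2 p3 : {vspace V}) : R :=
  complex.Im ((herm p1 p2 * herm p2 p3 * herm p3 p1) /
              (herm p1 p1 * herm p2 p2 * herm p3 p3)).

Definition gram (p1 p2 p3 : {vspace V}) : 'M[R[i]]_3 :=
  let p := [tuple p1; p2; p3] in
  \matrix_(j, k) herm (tnth p j) (tnth p k).

Definition beta (p1 p2 p3 : {vspace V}) : R[i] :=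
  \det (gram p1 p2 p3) / (herm p1 p1 * herm p2 p2 * herm p3 p3).

Definition lfun_det (f : 'End(V)) : R[i] :=
  \det (passmx.mxof (vbasis {:V}) (vbasis {:V}) f).

Definition unitary (f : 'End(V)) : Prop := isometry h h f.
Definition special_unitary (f : 'End(V)) : Prop := unitary f /\ lfun_det f = 1.

(* PU V as a group of transformations of the points: scalars act trivially. *)
Definition projective_unitary (g : {vspace V} -> {vspace V}) : Prop :=
  exists2 f : 'End(V), unitary f & g = (fun p => (f @: p)%VS).

Definition one_parameter_subgroup (B : R -> 'End(V)) : Prop :=
  B 0 = \1%VF /\ forall s t, B (s + t) = (B s \o B t)%VF.

Definition bendable (p1 p2 : {vspace V}) : Prop :=
  [/\ is_point p1 /\ is_point p2, p1 != p2, ~~ orthogonal_points p1 p2,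
      ~~ isotropic p1 /\ ~~ isotropic p2
    & has_signature (p1 + p2)%VS [:: 1; -1]].

Definition bending_frame (p1 p2 : {vspace V}) (v1 v2 : V) (a : R) : Prop :=
  [/\ [/\ v1 != 0, h v1 v1 = 0 & geodesic p1 p2 <[v1]>%VS],
      [/\ v2 != 0, h v2 v2 = 0 & geodesic p1 p2 <[v2]>%VS],
      h v1 v2 = 2^-1, a != 0
    & p1 = <[v1 + (sigma p1)%:~R *: v2]>%VS /\
      p2 = <[(expR (- a))%:C *: v1 +
             ((sigma p2)%:~R * (expR a)%:C) *: v2]>%VS].

Definition is_bending (p1 p2 : {vspace V}) (B : R -> 'End(V)) : Prop :=
  [/\ bendable p1 p2, one_parameter_subgroup B,
      forall s, special_unitary (B s)
    & exists v1 v2 a, bending_frame p1 p2 v1 v2 a /\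
        forall s, [/\ B s v1 = (expR (- a * s))%:C *: v1,
                      B s v2 = (expR (a * s))%:C *: v2
                    & {in orthov h (<[v1]> + <[v2]>)%VS, B s =1 id}]].

Definition triple : Type := ({vspace V} * {vspace V} * {vspace V})%type.

Definition bend12 (p q : triple) : Prop :=
  let: (p1, p2, p3) := p in
  exists B s, is_bending p1 p2 B /\ q = ((B s @: p1)%VS, (B s @: p2)%VS, p3).

Definition bend23 (p q : triple) : Prop :=
  let: (p1, p2, p3) := p in
  exists B s, is_bending p2 p3 B /\ q = (p1, (B s @: p2)%VS, (B s @: p3)%VS).

Definition bend (p q : triple) : Prop := bend12 p q \/ bend23 p q.

Definition bendings : triple -> triple -> Prop := clos_refl_trans triple bend.

End HermitianProjectivePlane.

(* Main.v *)
Require Import Defs.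
From HB Require Import structures.
From mathcomp Require Import all_boot all_order all_algebra.
From mathcomp Require Import sesquilinear complex.
From mathcomp Require Import all_classical all_reals all_analysis.
From mathcomp Require Import ring lra.
From Stdlib Require Import Relation_Operators.

Set Implicit Arguments.
Unset Strict Implicit.
Unset Printing Implicit Defensive.

Import Order.TTheory GRing.Theory Num.Theory.

Local Open Scope ring_scope.
Local Open Scope complex_scope.

(** Let u_j be a vector on p_j and g_jk = <u_j, u_k>. The numbers
x = |g12|^2 / (g11 g22), y = |g23|^2 / (g22 g33), z = |g31|^2 / (g33 g11) and
eta = g12 g23 g31 / (g11 g22 g33) = e + i alpha do not depend on the choice of
the u_j. As |eta|^2 = x y z and beta = 1 - x - y - z + 2 e, eliminating z puts
(x, y, e) on the surface
   (e - x y)^2 + alpha^2 = x y ((x - 1)(y - 1) - beta)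
([gram_surface]). Conversely the signs together with x, y and eta determine the
Gram matrix up to rescaling the u_j, hence the triple up to PU V
([congruent_triples]). So bendings have to connect any two points of the part of
this surface that belongs to the given signs.

A bending involving p1, p2 fixes x, alpha and beta, so it moves (y, e) along the
conic cut out by x = const. In the isotropic frame v1, v2 of the bending it
replaces A = |<u3, v2>|^2 and B = |<u3, v1>|^2 by l A and B / l for an arbitrary
l > 0, while y and e are affine functions of (A, B). Any prescribed (y, e) thus
determines A and B by a linear system, the equation of the surface says exactly
that the product A B has the right value, and the sign of y makes the solution
positive: every point of the conic over the correct sign of y is reached by a
single bending ([bending_solve], [bend12_reach]). This needs A B <> 0, and here
strong regularity enters: A B = 0 forces alpha = 0, so p3 is negative, whereas
<u3, u3> is then the square of the component of u3 orthogonal to the line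
p1 p2, which is nonnegative.

Let F(x, y) be the right-hand side of the equation. There is a point of the surface
over (x, y) if and only if F(x, y) >= alpha^2. Since the line p1 p2 is hyperbolic,
x (x - 1) > 0 ([ptance_hyperbolic]), and then F(x, k y) >= F(x, y) for all k >= 1
as soon as F(x, y) >= 0 ([surface_ray]). Given two points of the surface over
(x, y) and (x', y') one chooses Y = k y = k' y' with k, k' >= 1 and bends three
times, through points over (x, Y) and (x', Y) ([bendings_connect]).

As for the preservation of strong regularity, a triple that spans V with p2
orthogonal to neither p1 nor p3 lies in a real plane if and only if alpha = 0.
So strong regularity reads: p1, p2, p3 span V, are not isotropic, at most one is
positive, p2 is orthogonal to neither p1 nor p3, and alpha = 0 only if all are
negative ([strongly_regularP]). A bending involving p1, p2 preserves the line
p1 p2, the signs, x and alpha. The only condition left is that p2 and p3 stay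
nonorthogonal: clear if alpha <> 0, because g23 divides eta, and otherwise both
are negative and negative vectors are never orthogonal in signature ++-.

Bendings involving p2, p3 are bendings of the reversed triple
([bend23_rev]). *)

(** * Hermitian form and invariants of the Gram matrix *)

Section Form.
Variables (R : realType) (V : vectType R[i]).
Variable h : {hermitian_sym V for Num.conj}.
Implicit Types (u v w : V) (z : R[i]).

Definition normsq z : R := complex.Re z ^+ 2 + complex.Im z ^+ 2.
Definition hsq v : R := complex.Re (h v v).

Lemma herm_conj u v : h v u = Num.conj (h u v).
Proof. by rewrite (hermitian_subproof v u) expr0 mul1r. Qed.

Lemma hDl u v w : h (u + v) w = h u w + h v w. Proof. exact: linearDl. Qed.
Lemma hDr u v w : h u (v + w) = h u v + h u w. Proof. exact: linearDr. Qed.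
Lemma hZl z u v : h (z *: u) v = z * h u v. Proof. exact: linearZl_LR. Qed.
Lemma hZr z u v : h u (z *: v) = Num.conj z * h u v.
Proof. exact: linearZr_LR. Qed.

Lemma h_suml I (r : seq I) (E : I -> V) v :
  h (\sum_(i <- r) E i) v = \sum_(i <- r) h (E i) v.
Proof. exact: linear_sumlz. Qed.
Lemma h_sumr I (r : seq I) (E : I -> V) v :
  h v (\sum_(i <- r) E i) = \sum_(i <- r) h v (E i).
Proof. exact: linear_sumr. Qed.

Lemma conjc_real (x : R) : Num.conj (x%:C) = x%:C :> R[i].
Proof. exact: conjc_real. Qed.

Definition hE := (hDl, hDr, hZl, hZr, conjc_real).

Lemma hsqE v : h v v = (hsq v)%:C.
Proof.
have := herm_conj v v; rewrite /hsq; case: (h v v) => a b /= [].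
by move=> /eqP; rewrite -subr_eq0 opprK -mulr2n mulrn_eq0 => /eqP ->.
Qed.

Lemma mul_conj_normsq z : z * Num.conj z = (normsq z)%:C.
Proof.
case: z => a b; apply/eqP; rewrite eq_complex /normsq /=.
by apply/andP; split; apply/eqP; ring.
Qed.

Lemma normsq_ge0 z : 0 <= normsq z.
Proof. by rewrite addr_ge0 ?sqr_ge0. Qed.

Lemma normsq_eq0 z : (normsq z == 0) = (z == 0).
Proof. by rewrite paddr_eq0 ?sqr_ge0 // !sqrf_eq0 eq_complex. Qed.

Lemma normsq_gt0 z : (0 < normsq z) = (z != 0).
Proof. by rewrite lt_def normsq_ge0 andbT normsq_eq0. Qed.

Lemma normsqM z z' : normsq (z * z') = normsq z * normsq z'.
Proof. by case: z z' => a b [c d]; rewrite /normsq /=; ring. Qed.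

Lemma normsq_conj z : normsq (Num.conj z) = normsq z.
Proof. by case: z => a b; rewrite /normsq /= sqrrN. Qed.

Lemma hsqZ z v : hsq (z *: v) = normsq z * hsq v.
Proof.
apply: complexI; rewrite -hsqE hZl hZr rmorphM /= -mul_conj_normsq -hsqE.
by rewrite mulrA.
Qed.

(** The tance of two points: between negative points it is cosh^2 of the distance, in a
suitable normalization of the metric. *)
Definition tance u v : R := normsq (h u v) / (hsq u * hsq v).
Definition eta u v w : R[i] :=
  h u v * h v w * h w u / (h u u * h v v * h w w).

Lemma tanceC u v : tance u v = tance v u.
Proof. by rewrite /tance (herm_conj v u) normsq_conj [hsq u * _]mulrC. Qed.

Lemma tanceZ a b u v : a != 0 -> b != 0 -> tance (a *: u) (b *: v) = tance u v.
Proof.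
move=> a0 b0; rewrite /tance !hsqZ hZl hZr !normsqM normsq_conj.
have Na : normsq a != 0 by rewrite normsq_eq0.
have Nb : normsq b != 0 by rewrite normsq_eq0.
rewrite (_ : _ * hsq u * _ = (normsq a * normsq b) * (hsq u * hsq v)); last by ring.
by rewrite mulrA -mulf_div divff ?mul1r // mulf_neq0.
Qed.

Lemma etaZ a b c u v w : a != 0 -> b != 0 -> c != 0 ->
  eta (a *: u) (b *: v) (c *: w) = eta u v w.
Proof.
move=> a0 b0 c0; rewrite /eta !hE.
have Na : Num.conj a != 0 by rewrite conjC_eq0.
have Nb : Num.conj b != 0 by rewrite conjC_eq0.
have Nc : Num.conj c != 0 by rewrite conjC_eq0.
set D := h u u * h v v * h w w.
set k := a * Num.conj a * (b * Num.conj b) * (c * Num.conj c).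
rewrite [X in _ / X](_ : _ = k * D); last by rewrite /k /D; ring.
rewrite [X in X / _](_ : _ = k * (h u v * h v w * h w u)); last by rewrite /k; ring.
by rewrite -mulf_div divff ?mul1r // !mulf_neq0.
Qed.

Lemma eta_rev u v w : eta w v u = Num.conj (eta u v w).
Proof.
rewrite /eta rmorphM fmorphV !rmorphM /= -!herm_conj.
by congr (_ / _); ring.
Qed.

Lemma eta_normsq u v w : hsq u != 0 -> hsq v != 0 -> hsq w != 0 ->
  normsq (eta u v w) = tance u v * tance v w * tance w u.
Proof.
move=> u0 v0 w0; rewrite /eta /tance !hsqE -!rmorphM -fmorphV !normsqM.
rewrite {4}/normsq /= expr0n addr0; field.
by rewrite u0 v0 w0.
Qed.

End Form.

(** * Consequences of the signature *)

Lemma sgz_complex (R : realType) (x : R) : sgz (x%:C) = sgz x.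
Proof. by rewrite /sgz fmorph_eq0 ltcR. Qed.

Lemma det3 (F : comNzRingType) (A : 'M[F]_3) (a : nat -> nat -> F) :
  (forall i j : 'I_3, A i j = a i j) ->
  \det A = a 0 0 * a 1 1 * a 2 2 - a 0 1 * a 1 0 * a 2 2
           - a 1 2 * a 2 1 * a 0 0 - a 2 0 * a 0 2 * a 1 1
           + a 0 1 * a 1 2 * a 2 0 + a 0 2 * a 1 0 * a 2 1.
Proof.
move=> AE; rewrite (expand_det_row _ ord0) !big_ord_recl big_ord0 /cofactor.
rewrite !(expand_det_row _ ord0) !big_ord_recl !big_ord0 /cofactor !det_mx11.
rewrite !mxE !AE /= /bump /=.
by ring.
Qed.

Section Signature.
Variables (R : realType) (V : vectType R[i]).
Variable h : {hermitian_sym V for Num.conj}.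
Hypothesis sigV : has_signature h {:V}%VS [:: 1; 1; -1].
Implicit Types (u v w : V) (z : R[i]).
Local Notation hsq := (hsq h).

(** The only use made of the signature: the form is positive definite on some
hyperplane, here the span of the first two vectors of an orthogonal basis. *)
Lemma signature_definite_kernel : exists phi : {scalar V},
  forall v, phi v = 0 -> 0 <= hsq v /\ (hsq v = 0 -> v = 0).
Proof.
case: sigV => e [bas orth sgn].
pose i0 : 'I_3 := ord0; pose i1 : 'I_3 := lift ord0 ord0.
pose i2 : 'I_3 := ord_max.
have e0 : 0 < hsq e`_0.
  by have := sgn i0; rewrite hsqE sgz_complex /= => /eqP; rewrite sgz_cp0.
have e1 : 0 < hsq e`_1.
  by have := sgn i1; rewrite hsqE sgz_complex /= => /eqP; rewrite sgz_cp0.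
have e01 : h e`_0 e`_1 = 0 by exact: (orth i0 i1).
have e10 : h e`_1 e`_0 = 0 by exact: (orth i1 i0).
exists (coord e i2) => v v2.
have vE : v = coord e i0 v *: e`_0 + coord e i1 v *: e`_1.
  rewrite {1}(coord_basis bas (memvf v)) !big_ord_recl big_ord0.
  rewrite (_ : lift ord0 (lift ord0 ord0) = i2); last exact: val_inj.
  by rewrite v2 scale0r !addr0.
have sqE : hsq v = normsq (coord e i0 v) * hsq e`_0 +
                   normsq (coord e i1 v) * hsq e`_1.
  apply: complexI; rewrite -hsqE {1 2}vE !hE e01 e10 !mulr0 addr0 add0r !hsqE.
  by rewrite rmorphD !rmorphM /= -!mul_conj_normsq !mulrA.
split; first by rewrite sqE addr_ge0 ?mulr_ge0 ?normsq_ge0 // ltW.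
move=> v0; have := sqE; rewrite v0 => /esym/eqP.
rewrite paddr_eq0 ?mulr_ge0 ?normsq_ge0 ?(ltW e0) ?(ltW e1) //.
rewrite !mulf_eq0 (gt_eqF e0) (gt_eqF e1) !orbF !normsq_eq0.
by case/andP=> /eqP c0 /eqP c1; rewrite vE c0 c1 !scale0r addr0.
Qed.

(** The plane spanned by n and u meets the definite hyperplane ker phi in the
vector phi(n) u - phi(u) n, whose square is |phi(n)|^2 <u,u> + |phi(u)|^2 <n,n>. *)
Lemma orth_negative n u : hsq n < 0 -> h u n = 0 -> u != 0 -> 0 < hsq u.
Proof.
move=> n0 un u0; have [phi def] := signature_definite_kernel.
have nu : h n u = 0 by rewrite herm_conj un conjC0.
have pn0 : phi n != 0.
  by apply/eqP => /def [+ _]; rewrite leNgt n0.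
have pw : phi (phi n *: u + (- phi u) *: n) = 0.
  by rewrite linearD !linearZ /=; ring.
have [w0 w1] := def _ pw.
have sqw : hsq (phi n *: u + (- phi u) *: n) =
           normsq (phi n) * hsq u + normsq (phi u) * hsq n.
  apply: complexI; rewrite rmorphD !rmorphM /= -!mul_conj_normsq -!hsqE !hE un nu.
  by rewrite rmorphN; ring.
have pN : 0 < normsq (phi n) by rewrite normsq_gt0.
have sq0 : 0 <= hsq u.
  rewrite -(pmulr_rge0 _ pN); move: w0; rewrite sqw => w0.
  rewrite -(lerDr (normsq (phi u) * hsq n)) in w0 *.
  have := mulr_ge0_le0 (normsq_ge0 (phi u)) (ltW n0); lra.
rewrite lt_def sq0 andbT; apply/eqP => su0.
move: sqw w0; rewrite su0 mulr0 add0r => sqw; rewrite sqw nmulr_lge0 // => pu.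
have pu0 : phi u = 0.
  by apply/eqP; rewrite -normsq_eq0 eq_le pu normsq_ge0.
move/eqP: u0; apply; have := def _ pu0 => -[_]; exact.
Qed.

(** Reversed Cauchy-Schwarz inequality: the component w of u orthogonal to v is
positive, and <w,w> = <u,u> (1 - tance u v). *)
Lemma tance_hyperbolic_neg u v : hsq u != 0 -> hsq v < 0 -> h u v != 0 ->
  u \notin <[v]>%VS -> 0 < tance h u v * (tance h u v - 1).
Proof.
move=> u0 v0 uv nuv; set w := u + (- (h u v / h v v)) *: v.
have vv0 : h v v != 0 by rewrite hsqE fmorph_eq0 lt_eqF.
have w0 : w != 0.
  apply: contra nuv; rewrite /w scaleNr subr_eq0 => /eqP ->.
  by rewrite memvZ // memv_line.
have wv : h w v = 0 by rewrite !hE mulNr divfK // subrr.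
have := orth_negative v0 wv w0.
have -> : hsq w = hsq u - normsq (h u v) / hsq v.
  apply: complexI; rewrite -hsqE {2}/w hDr hZr wv mulr0 addr0 !hE.
  rewrite rmorphB rmorphM fmorphV /= -mul_conj_normsq -!hsqE (herm_conj h u v).
  by rewrite mulNr mulrAC.
set N := normsq _ => lt0.
have N0 : 0 < N by rewrite normsq_gt0.
have vn : hsq v != 0 by rewrite lt_eqF.
have E : tance h u v * (tance h u v - 1) =
  (hsq u)^-1 ^+ 2 * (- (hsq v)^-1) * N * (hsq u - N / hsq v).
  by rewrite /tance -/N; field; rewrite u0 vn.
have i2 : 0 < (hsq u)^-1 ^+ 2 by rewrite exprn_even_gt0 //= invr_eq0.
have v2 : 0 < - (hsq v)^-1 by rewrite oppr_gt0 invr_lt0.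
by rewrite E; apply: mulr_gt0 lt0; apply: mulr_gt0 N0; apply: mulr_gt0 i2 v2.
Qed.

Lemma tance_hyperbolic u v : hsq u != 0 -> hsq v != 0 ->
  hsq u < 0 \/ hsq v < 0 -> h u v != 0 ->
  v != 0 -> u \notin <[v]>%VS -> 0 < tance h u v * (tance h u v - 1).
Proof.
move=> u0 v0 [un|vn] uv vz nuv; last exact: tance_hyperbolic_neg.
rewrite tanceC; apply: tance_hyperbolic_neg => //.
  by rewrite herm_conj conjC_eq0.
apply: contra nuv => /vlineP [k vk].
apply/vlineP; exists k^-1; rewrite vk scalerA mulVf ?scale1r //.
by apply: contraNneq vz => k0; rewrite vk k0 scale0r.
Qed.

End Signature.

(** * Expressions in points, computed on arbitrary representatives *)

Section Lines.
Variables (R : realType) (V : vectType R[i]).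
Variable h : {hermitian_sym V for Num.conj}.
Implicit Types (p q : {vspace V}) (u v w : V).

Lemma point_rep p : is_point p -> rep p != 0 /\ p = <[rep p]>%VS.
Proof.
move=> p1; have p0 : rep p != 0 by rewrite vpick0 -dimv_eq0 p1.
split=> //; apply/esym/eqP; rewrite eqEdim -memvE memv_pick p1 dim_vline.
by rewrite -/(rep p) p0.
Qed.

Lemma line_point u : u != 0 -> is_point <[u]>%VS.
Proof. by rewrite /is_point dim_vline => ->. Qed.

Lemma rep_line u : u != 0 -> exists2 k : R[i], k != 0 & rep <[u]>%VS = k *: u.
Proof.
move=> u0; have /vlineP [k kE] := memv_pick <[u]>%VS.
exists k => //; have [r0 _] := point_rep (line_point u0).
by apply: contraNneq r0 => k0; rewrite /rep kE k0 scale0r.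
Qed.

Lemma line_eqZ k u : k != 0 -> <[k *: u]>%VS = <[u]>%VS.
Proof.
move=> k0; apply/eqP; rewrite eqEsubv -!memvE memvZ ?memv_line //=.
by apply/vlineP; exists k^-1; rewrite scalerA mulVf // scale1r.
Qed.

Lemma herm_lineE u v : u != 0 -> v != 0 ->
  exists k l : R[i], [/\ k != 0, l != 0 &
   herm h <[u]>%VS <[v]>%VS = k * Num.conj l * h u v].
Proof.
move=> u0 v0; have [k k0 kE] := rep_line u0; have [l l0 lE] := rep_line v0.
by exists k, l; rewrite /herm kE lE !hE mulrA.
Qed.

Lemma orthogonal_lineE u v : u != 0 -> v != 0 ->
  orthogonal_points h <[u]>%VS <[v]>%VS = (h u v == 0).
Proof.
move=> u0 v0; rewrite /orthogonal_points.
have [k [l [k0 l0 ->]]] := herm_lineE u0 v0.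
by rewrite !mulf_eq0 conjC_eq0 (negPf k0) (negPf l0).
Qed.

Lemma hsq_line u : u != 0 ->
  exists2 c : R, 0 < c & herm h <[u]>%VS <[u]>%VS = (c * hsq h u)%:C.
Proof.
move=> u0; have [k k0 kE] := rep_line u0.
by exists (normsq k); rewrite ?normsq_gt0 // /herm kE hsqE hsqZ.
Qed.

Lemma isotropic_lineE u : u != 0 -> isotropic h <[u]>%VS = (hsq h u == 0).
Proof.
move=> /hsq_line [c c0]; rewrite /isotropic => ->.
by rewrite fmorph_eq0 mulf_eq0 (gt_eqF c0).
Qed.

Definition ptance p q := tance h (rep p) (rep q).
Definition peta p1 p2 p3 := eta h (rep p1) (rep p2) (rep p3).

Lemma ptance_lineE u v : u != 0 -> v != 0 ->
  ptance <[u]>%VS <[v]>%VS = tance h u v.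
Proof.
move=> /rep_line [k k0 kE] /rep_line [l l0 lE].
by rewrite /ptance kE lE tanceZ.
Qed.

Lemma peta_lineE u v w : u != 0 -> v != 0 -> w != 0 ->
  peta <[u]>%VS <[v]>%VS <[w]>%VS = eta h u v w.
Proof.
move=> /rep_line [k k0 kE] /rep_line [l l0 lE] /rep_line [m m0 mE].
by rewrite /peta kE lE mE etaZ.
Qed.

Lemma alphaE p1 p2 p3 : alpha h p1 p2 p3 = complex.Im (peta p1 p2 p3).
Proof. by []. Qed.

(** Indexing the points by natural numbers lets the entries of the matrix compute. *)
Lemma det_gram (p : nat -> {vspace V}) (g := fun i j => herm h (p i) (p j)) :
  \det (gram h (p 0) (p 1) (p 2)) = g 0 0 * g 1 1 * g 2 2 - g 0 1 * g 1 0 * g 2 2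
           - g 1 2 * g 2 1 * g 0 0 - g 2 0 * g 0 2 * g 1 1
           + g 0 1 * g 1 2 * g 2 0 + g 0 2 * g 1 0 * g 2 1.
Proof.
apply: det3 => i j; rewrite mxE !(tnth_nth 0%VS) /g.
by case: i j => [[|[|[|i]]] ?] [[|[|[|j]]] ?].
Qed.

Lemma betaE p1 p2 p3 :
  ~~ isotropic h p1 -> ~~ isotropic h p2 -> ~~ isotropic h p3 ->
  beta h p1 p2 p3 = (1 - ptance p1 p2 - ptance p2 p3 - ptance p3 p1
                     + 2 * complex.Re (peta p1 p2 p3))%:C.
Proof.
rewrite /isotropic /beta /herm /ptance /peta => n1 n2 n3.
set a := rep p1; set b := rep p2; set c := rep p3.
have detE := det_gram (nth p1 [:: p1; p2; p3]).
rewrite /= /herm -/a -/b -/c in detE.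
have ReE z : (2 * complex.Re z)%:C = z + Num.conj z.
  case: z => x y; apply/eqP; rewrite eq_complex /=.
  by apply/andP; split; apply/eqP; ring.
rewrite detE [RHS]rmorphD /= ReE -eta_rev !rmorphB /= /eta /tance rmorph1.
rewrite !fmorph_div !rmorphM /= -!mul_conj_normsq -!hsqE -!herm_conj.
by field; rewrite n1 n2 n3.
Qed.

End Lines.

(** * Strong regularity in terms of invariants *)

Section Regular.
Variables (R : realType) (V : vectType R[i]).
Variable h : {hermitian_sym V for Num.conj}.
Hypothesis dimV : \dim {:V} = 3%N.
Implicit Types (p q : {vspace V}) (u v w : V).

Lemma Im_eq0_real (z : R[i]) : (complex.Im z == 0) = (z \is Num.real).
Proof. by case: z => a b; rewrite complex_real. Qed.

Lemma exists_notin (U : {vspace V}) : (\dim U < \dim {:V})%N ->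
  exists v, v \notin U.
Proof.
rewrite ltnNge => lt; apply: contrapT => nv; case/negP: lt.
apply/dimvS/subvP => v _; apply: contrapT => /negP vU; apply: nv; by exists v.
Qed.

Lemma full_noncollinear p1 p2 p3 : is_point p1 ->
  (p1 + p2 + p3)%VS = fullv <->
  ~ (exists L : {vspace V},
       [/\ \dim L = 2%N, (p1 <= L)%VS, (p2 <= L)%VS & (p3 <= L)%VS]).
Proof.
move=> pt1; split=> [full [L [dL l1 l2 l3]]|noL].
  have: (fullv <= L)%VS by rewrite -full !subv_add l1 l2.
  by move/dimvS; rewrite dimV dL.
apply/eqP; rewrite eqEdim subvf /= dimV ltnNge; apply/negP => le2.
apply: noL; set U := (p1 + p2 + p3)%VS in le2 *.
have s1 : (p1 <= U)%VS by rewrite /U -addvA addvSl.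
have s2 : (p2 <= U)%VS by rewrite /U [(p1 + p2)%VS]addvC -addvA addvSl.
have s3 : (p3 <= U)%VS by rewrite addvSr.
move: le2; rewrite leq_eqVlt => /orP [/eqP dU|lt2]; first by exists U.
have dU : \dim U = 1%N.
  by apply/eqP; rewrite eqn_leq -ltnS lt2 -pt1 dimvS.
have [v vU] : exists v, v \notin U by apply: exists_notin; rewrite dU dimV.
exists (U + <[v]>)%VS; split; try exact: subv_trans (addvSl _ _).
rewrite dimv_disjoint_sum ?dU ?dim_vline.
  by case: eqP vU => // ->; rewrite mem0v.
apply/eqP; rewrite -subv0; apply/subvP => w; rewrite memv_cap => /andP [wU].
move=> /vlineP [k wk]; rewrite memv0; apply: contraNT vU => w0.
have k0 : k != 0 by apply: contraNneq w0 => k0; rewrite wk k0 scale0r.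
by rewrite -[v](scalerK k0) -wk memvZ.
Qed.

Lemma full_basis u1 u2 u3 : (<[u1]> + <[u2]> + <[u3]>)%VS = fullv ->
  basis_of {:V} [tuple u1; u2; u3].
Proof.
move=> full; rewrite basisEdim dimV andbT -full !span_cons span_nil addv0.
by rewrite addvA.
Qed.

Lemma real_span_mem n (w : n.-tuple V) (i : 'I_n) : real_span w w`_i.
Proof.
exists (fun j => (j == i)%:R); rewrite (bigD1 i) //= eqxx scale1r big1 ?addr0 //.
by move=> j /negPf ->; rewrite scale0r.
Qed.

Lemma real_span_sub n (w : n.-tuple V) v : real_span w v -> v \in <<w>>%VS.
Proof.
move=> [x ->]; apply: memv_suml => i _; apply/memvZ/memv_span/mem_nth.
by rewrite size_tuple.
Qed.

Lemma proj_image_rep W p : proj_image W p ->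
  exists w, [/\ W w, w != 0 & p = <[w]>%VS].
Proof. by case=> w [Ww /eqP w0] <-; exists w. Qed.

(** The real subspace of a geodesic generates a complex subspace of dimension at
most 2. *)
Lemma full_not_geodesic p1 p2 p3 : (p1 + p2 + p3)%VS = fullv ->
  ~ (exists G, [/\ is_geodesic h G, G p1, G p2 & G p3]).
Proof.
move=> full [_ [[W [[w _ WE] _ _ ->]] g1 g2 g3]].
have sub p : proj_image W p -> (p <= <<w>>)%VS.
  move=> /proj_image_rep [v [Wv _ ->]]; rewrite -memvE; apply: real_span_sub.
  by rewrite -WE.
have: (fullv <= <<w>>)%VS by rewrite -full !subv_add !sub.
by move/dimvS; rewrite dimV => /leq_trans /(_ (dim_span _)); rewrite size_tuple.
Qed.

Lemma real_plane_alpha p1 p2 p3 :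
  (exists P, [/\ is_real_plane h P, P p1, P p2 & P p3]) -> alpha h p1 p2 p3 = 0.
Proof.
move=> [_ [[W [_ _ Wr ->]]]].
move=> /proj_image_rep [w1 [W1 n1 ->]] /proj_image_rep [w2 [W2 n2 ->]].
move=> /proj_image_rep [w3 [W3 n3 ->]].
rewrite alphaE peta_lineE //; apply/eqP; rewrite Im_eq0_real /eta.
by rewrite rpredM ?rpredV ?rpredM ?Wr.
Qed.

(** Multiplying the outer vectors by g21 and g23 makes the products with the middle
one real; the last product then is g12 g23 g31. *)
Lemma alpha_real_plane p1 p2 p3 : is_point p1 -> is_point p2 -> is_point p3 ->
  ~~ isotropic h p1 -> ~~ isotropic h p2 -> ~~ isotropic h p3 ->
  ~~ orthogonal_points h p2 p1 -> ~~ orthogonal_points h p2 p3 ->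
  (p1 + p2 + p3)%VS = fullv -> alpha h p1 p2 p3 = 0 ->
  exists P, [/\ is_real_plane h P, P p1, P p2 & P p3].
Proof.
move=> /point_rep [+ +] /point_rep [+ +] /point_rep [+ +].
move: (rep p1) (rep p2) (rep p3) => u1 u2 u3 n1 -> n2 -> n3 ->.
rewrite !isotropic_lineE // !orthogonal_lineE // alphaE peta_lineE //.
move=> i1 i2 i3 o21 o23.
pose w1 := h u2 u1 *: u1; pose w3 := h u2 u3 *: u3.
rewrite -(line_eqZ u1 o21) -(line_eqZ u3 o23) -/w1 -/w3 => full /eqP.
rewrite Im_eq0_real => er.
have bas := full_basis full; set w := [tuple w1; u2; w3] in bas.
have m1 : real_span w w1 by apply: (real_span_mem w ord0).
have m2 : real_span w u2 by apply: (real_span_mem w (@Ordinal 3 1 isT)).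
have m3 : real_span w w3 by apply: (real_span_mem w ord_max).
exists (proj_image (real_span w)); split; last 3 first.
- by exists w1 => //; split=> // /eqP; rewrite scaler_eq0 (negPf o21) (negPf n1).
- by exists u2 => //; split=> // /eqP; rewrite (negPf n2).
- by exists w3 => //; split=> // /eqP; rewrite scaler_eq0 (negPf o23) (negPf n3).
exists (real_span w); split=> //.
- exists w => // x x0 i; apply: complexI; rewrite rmorph0.
  by have /freeP fr := basis_free bas; exact: (fr (fun j => (x j)%:C)).
- move=> U WU; apply/eqP; rewrite eqEsubv subvf -(span_basis bas).
  by apply/span_subvP => v; rewrite !inE => /or3P [] /eqP ->; exact: WU.
have real_sq v : h v v \is Num.real.
  by rewrite hsqE; apply/complex_realP; exists (hsq h v).
have r12 : h w1 u2 \is Num.real.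
  by rewrite hZl [h u1 u2]herm_conj mul_conj_normsq; apply/complex_realP; eexists.
have r23 : h u2 w3 \is Num.real.
  by rewrite hZr mulrC mul_conj_normsq; apply/complex_realP; eexists.
have r31 : h w3 w1 \is Num.real.
  rewrite hZl hZr -herm_conj.
  rewrite (_ : _ * _ = eta h u1 u2 u3 * (h u1 u1 * h u2 u2 * h u3 u3)).
    by apply: rpredM er _; apply: rpredM (real_sq _); apply: rpredM.
  rewrite /eta mulfVK; last by rewrite !hsqE !mulf_neq0 // fmorph_eq0.
  by ring.
have sym u v : h u v \is Num.real -> h v u \is Num.real.
  move=> r; rewrite herm_conj; case/complex_realP: r => k ->.
  by rewrite conjc_real; apply/complex_realP; exists k.
have rw (i j : 'I_3) : h w`_i w`_j \is Num.real.
  case: i j => [[|[|[|i]]] ?] [[|[|[|j]]] ?] //=; try exact: real_sq;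
  by [exact: r12|exact: r23|exact: r31|exact: sym r12|exact: sym r23|exact: sym r31].
move=> _ _ [x ->] [y ->]; rewrite h_suml rpred_sum // => i _.
rewrite h_sumr rpred_sum // => j _; rewrite hZl hZr conjc_real.
by rewrite !rpredM ?rw //; apply/complex_realP; eexists.
Qed.

Lemma strongly_regularP p1 p2 p3 :
  strongly_regular h p1 p2 p3 <->
  [/\ [/\ is_point p1, is_point p2 & is_point p3],
      [/\ ~~ isotropic h p1, ~~ isotropic h p2 & ~~ isotropic h p3],
      ~~ orthogonal_points h p2 p1 /\ ~~ orthogonal_points h p2 p3,
      (count (positive h) [:: p1; p2; p3] <= 1)%N
    & (p1 + p2 + p3)%VS = fullv /\
      (alpha h p1 p2 p3 = 0 -> [/\ negative h p1, negative h p2 & negative h p3])].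
Proof.
split.
  move=> [[pt iso _ orth cnt] noL plane]; have [pt1 pt2 pt3] := pt.
  have full : (p1 + p2 + p3)%VS = fullv by apply/full_noncollinear.
  split=> //; split=> // al; apply: plane.
  by case: iso orth => ? ? ? [? ?]; apply: alpha_real_plane.
move=> [pt iso orth cnt [full al]]; have [pt1 pt2 pt3] := pt.
split; first by split=> //; exact: full_not_geodesic.
  exact/full_noncollinear.
by move=> /real_plane_alpha.
Qed.

End Regular.

(** * Real algebra: the surface of admissible invariants *)

Section Surface.
Variable R : realType.
Implicit Types (s t x y k : R).

(** The invariants of the triple v1 + s1 v2, t^-1 v1 + s2 t v2, u for isotropic v1, v2
with <v1, v2> = 1/2. The other arguments are G = <u,u>, A = |<u,v2>|^2,
B = |<u,v1>|^2 and the real and imaginary parts K, M of <u,v1> <v2,u>, so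
that A B = K^2 + M^2. *)
Definition frame_tance12 s1 s2 t := (s2 * t + s1 / t) ^+ 2 / 4 / (s1 * s2) : R.
Definition frame_tance23 s2 t G A B K :=
  (B / t ^+ 2 + t ^+ 2 * A + 2 * s2 * K) / (s2 * G) : R.
Definition frame_tance31 s1 G A B K := (B + A + 2 * s1 * K) / (s1 * G) : R.
Definition frame_re_eta s1 s2 t G A B K :=
  (s2 * t + s1 / t) / 2 *
  (B / t + s1 * s2 * t * A + (s1 / t + s2 * t) * K) / (s1 * s2 * G) : R.
Definition frame_alpha s1 s2 t G M :=
  (s2 * t + s1 / t) / 2 * ((s2 * t - s1 / t) * M) / (s1 * s2 * G) : R.

Definition gram_det x y z e := 1 - x - y - z + 2 * e : R.

Definition on_surface a b x y e : Prop :=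
  (e - x * y) ^+ 2 + a ^+ 2 = x * y * ((x - 1) * (y - 1) - b) :> R.

Lemma sign_cases s : s ^+ 2 = 1 -> s = 1 \/ s = -1.
Proof. by move/eqP; rewrite sqrf_eq1 => /orP [] /eqP ->; [left|right]. Qed.

(** The normalized Gram determinant of the triple is that of the first two points,
1 - x, times the normalized square of the component of u orthogonal to their
line, which is G - 4 K; so A and B cancel out. *)
Lemma gram_detE s1 s2 t G A B K : s1 ^+ 2 = 1 -> s2 ^+ 2 = 1 -> t != 0 -> G != 0 ->
  gram_det (frame_tance12 s1 s2 t) (frame_tance23 s2 t G A B K)
    (frame_tance31 s1 G A B K) (frame_re_eta s1 s2 t G A B K)
  = (1 - frame_tance12 s1 s2 t) * (G - 4 * K) / G.
Proof.
move=> /sign_cases [] -> /sign_cases [] -> t0 G0;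
rewrite /gram_det /frame_tance12 /frame_tance23 /frame_tance31 /frame_re_eta;
by field; rewrite t0 G0.
Qed.

(** In the coordinates (A, B) the equation of the surface becomes the relation
A B = K^2 + M^2. *)
Lemma surface_frame s1 s2 t G A B K M :
  s1 ^+ 2 = 1 -> s2 ^+ 2 = 1 -> t != 0 -> G != 0 ->
  let x := frame_tance12 s1 s2 t in let y := frame_tance23 s2 t G A B K in
  let e := frame_re_eta s1 s2 t G A B K in
  (e - x * y) ^+ 2 + frame_alpha s1 s2 t G M ^+ 2
   - x * y * ((x - 1) * (y - 1) - (1 - x) * (G - 4 * K) / G)
  = ((s2 * t + s1 / t) / 2 * (s2 * t - s1 / t) / G) ^+ 2 * (K ^+ 2 + M ^+ 2 - A * B).
Proof.
move=> /sign_cases [] -> /sign_cases [] -> t0 G0 /=;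
rewrite /frame_tance12 /frame_tance23 /frame_re_eta /frame_alpha;
by field; rewrite t0 G0.
Qed.

Lemma frame_linear_solve s1 s2 t G K y e :
  s1 ^+ 2 = 1 -> s2 ^+ 2 = 1 -> t != 0 -> G != 0 ->
  t ^+ 2 + s1 * s2 != 0 -> t ^+ 2 - s1 * s2 != 0 ->
  exists A B, frame_tance23 s2 t G A B K = y /\ frame_re_eta s1 s2 t G A B K = e.
Proof.
move=> s1E s2E t0 G0 c0 d0.
(* The system is B / t^2 + t^2 A = Y, B / t + s1 s2 t A = X. *)
pose Y := s2 * G * y - 2 * s2 * K.
pose X := s1 * s2 * G * e / ((s2 * t + s1 / t) / 2) - (s1 / t + s2 * t) * K.
exists ((Y - X / t) / (t ^+ 2 - s1 * s2)).
exists ((t * X - s1 * s2 * Y) * t ^+ 2 / (t ^+ 2 - s1 * s2)).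
have c1 : s2 * t + s1 / t != 0.
  rewrite (_ : _ + _ = s2 / t * (t ^+ 2 + s1 * s2)).
    by rewrite !mulf_neq0 ?invr_eq0 // -sqrf_eq0 s2E oner_eq0.
  by case: (sign_cases s2E) => ->; field.
rewrite /frame_tance23 /frame_re_eta.
set c := s2 * t + s1 / t in c1 *.
have G2 : s2 * G != 0 by rewrite mulf_neq0 // -sqrf_eq0 s2E oner_eq0.
have G12 : s1 * s2 * G != 0.
  by rewrite -mulrA mulf_neq0 // -sqrf_eq0 s1E oner_eq0.
split.
  apply: (canLR (mulfK G2)); apply: (canLR (subrK _)).
  rewrite [y * _]mulrC -/Y.
  by field; rewrite t0 d0.
apply: (canLR (mulfK G12)); rewrite -[RHS](divfK (_ : c / 2 != 0)) ?mulf_neq0 //.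
rewrite [RHS]mulrC; congr (_ * _); apply: (canLR (subrK _)).
rewrite [e * _]mulrC -/X.
have e1 : (s1 * s2) ^+ 2 = 1 by rewrite exprMn s1E s2E mulr1.
move: e1 d0; set s := s1 * s2 => /sign_cases [] -> d0.
  by field; rewrite t0 d0.
by rewrite opprK in d0 *; field; rewrite t0 d0.
Qed.

Lemma frame_tance12_hyperbolic s1 s2 t : s1 ^+ 2 = 1 -> s2 ^+ 2 = 1 -> t != 0 ->
  frame_tance12 s1 s2 t * (frame_tance12 s1 s2 t - 1) =
  ((s2 * t + s1 / t) / 2 * (s2 * t - s1 / t)) ^+ 2 / 4.
Proof. by move=> /sign_cases [] -> /sign_cases [] -> t0; rewrite /frame_tance12; field. Qed.

(** The new values A' = l A and B' = B / l come from [frame_linear_solve], and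
[surface_frame] gives A' B' = A B > 0. For positivity it remains to see that
B' / t^2 + t^2 A' = s2 G y - 2 s2 K is positive. As alpha^2 >= 0 and x (x - 1) > 0,
the surface equation yields y (y - 4 K / G) >= 0, that is s2 G y >= 4 s2 K because
s2 G y > 0. *)
Lemma bending_solve s1 s2 t G A B K M y e :
  s1 ^+ 2 = 1 -> s2 ^+ 2 = 1 -> t != 0 -> G != 0 ->
  t ^+ 2 + s1 * s2 != 0 -> t ^+ 2 - s1 * s2 != 0 ->
  0 < A -> 0 < B -> A * B = K ^+ 2 + M ^+ 2 -> 0 < s2 * G * y ->
  on_surface (frame_alpha s1 s2 t G M) ((1 - frame_tance12 s1 s2 t) * (G - 4 * K) / G)
    (frame_tance12 s1 s2 t) y e ->
  exists2 l, 0 < l &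
    frame_tance23 s2 t G (l * A) (B / l) K = y /\
    frame_re_eta s1 s2 t G (l * A) (B / l) K = e.
Proof.
move=> s1E s2E t0 G0 c0 d0 A0 B0 AB yp surf.
have [A' [B' [yE eE]]] := frame_linear_solve K y e s1E s2E t0 G0 c0 d0.
have c1 : s2 * t + s1 / t = s2 / t * (t ^+ 2 + s1 * s2).
  by case: (sign_cases s2E) => ->; field.
have d1 : s2 * t - s1 / t = s2 / t * (t ^+ 2 - s1 * s2).
  by case: (sign_cases s2E) => ->; field.
have s20 : s2 != 0 by rewrite -sqrf_eq0 s2E oner_eq0.
have AB' : A' * B' = K ^+ 2 + M ^+ 2.
  have := surface_frame A' B' K M s1E s2E t0 G0; rewrite /= yE eE.
  move: surf; rewrite /on_surface => /eqP; rewrite -subr_eq0 => /eqP -> /esym/eqP.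
  rewrite mulf_eq0 sqrf_eq0 c1 d1 subr_eq0 !mulf_eq0 !invr_eq0.
  by rewrite (negPf s20) (negPf t0) (negPf c0) (negPf d0) (negPf G0) pnatr_eq0 => /eqP.
have AB0 : 0 < A' * B' by rewrite AB' -AB mulr_gt0.
have YE : B' / t ^+ 2 + t ^+ 2 * A' = s2 * G * y - 2 * s2 * K.
  by rewrite -yE /frame_tance23; field; rewrite G0 s20.
have x_hyp : 0 < frame_tance12 s1 s2 t * (frame_tance12 s1 s2 t - 1).
  rewrite frame_tance12_hyperbolic // divr_gt0 // exprn_even_gt0 //= c1 d1.
  by rewrite !mulf_neq0 ?invr_eq0.
(* Divide the surface equation by x (x - 1). *)
have yK : 0 <= y * (y - 4 * K / G).
  rewrite -(pmulr_rge0 _ x_hyp).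
  have : 0 <= frame_tance12 s1 s2 t * y * ((frame_tance12 s1 s2 t - 1) * (y - 1) -
                (1 - frame_tance12 s1 s2 t) * (G - 4 * K) / G).
    by rewrite -surf addr_ge0 ?sqr_ge0.
  suff <- : frame_tance12 s1 s2 t * y * ((frame_tance12 s1 s2 t - 1) * (y - 1) -
              (1 - frame_tance12 s1 s2 t) * (G - 4 * K) / G) =
      frame_tance12 s1 s2 t * (frame_tance12 s1 s2 t - 1) * (y * (y - 4 * K / G)) by [].
  by field.
have Yp : 0 < s2 * G * y - 2 * s2 * K.
  have : 0 <= (s2 * G * y) * (s2 * G * y - 4 * s2 * K).
    rewrite (_ : _ * _ = G ^+ 2 * (y * (y - 4 * K / G))).
      by rewrite mulr_ge0 // sqr_ge0.
    by case: (sign_cases s2E) => ->; field.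
  rewrite (pmulr_rge0 _ yp); lra.
have A'0 : 0 < A'.
  rewrite ltNge; apply/negP => A'0; move: Yp; rewrite -YE ltNge; case/negP.
  have B'0 : B' <= 0.
    rewrite leNgt; apply/negP => B'0; move: AB0; rewrite ltNge; case/negP.
    exact: mulr_le0_ge0 A'0 (ltW B'0).
  rewrite -[leRHS]addr0 lerD //; first by rewrite mulr_le0_ge0 // invr_ge0 sqr_ge0.
  by rewrite mulr_ge0_le0 // sqr_ge0.
exists (A' / A); first by rewrite divr_gt0.
have -> : A' / A * A = A' by rewrite divfK // gt_eqF.
have -> : B / (A' / A) = B'.
  have n1 : A != 0 by rewrite gt_eqF.
  have n2 : A' != 0 by rewrite gt_eqF.
  apply: (mulfI n2); rewrite AB' -AB; field; by rewrite n1 n2.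
by [].
Qed.

(** With F = x y ((x - 1)(y - 1) - b), the value at k y is
k (F + (k - 1) x (x - 1) y^2). *)
Lemma surface_ray a b x y k :
  0 < x * (x - 1) -> 1 <= k -> a ^+ 2 <= x * y * ((x - 1) * (y - 1) - b) ->
  a ^+ 2 <= x * (k * y) * ((x - 1) * (k * y - 1) - b).
Proof.
move=> x0 k1 le; set F := x * y * _ in le.
have -> : x * (k * y) * ((x - 1) * (k * y - 1) - b) =
          F + (k - 1) * F + k * (k - 1) * (x * (x - 1)) * y ^+ 2.
  by rewrite /F; ring.
apply: (le_trans le); have F0 : 0 <= F by apply: le_trans le; exact: sqr_ge0.
have k0 : 0 <= k by apply: le_trans ler01 k1.
have k10 : 0 <= k - 1 by rewrite subr_ge0.
rewrite -addrA lerDl addr_ge0 // ?(mulr_ge0 k10) //.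
by apply: mulr_ge0 (sqr_ge0 y); apply: mulr_ge0 (ltW x0); apply: mulr_ge0.
Qed.

Lemma surface_exists a b x y : a ^+ 2 <= x * y * ((x - 1) * (y - 1) - b) ->
  exists e, on_surface a b x y e.
Proof.
rewrite -subr_ge0 => /sqr_sqrtr S; exists (x * y + Num.sqrt
  (x * y * ((x - 1) * (y - 1) - b) - a ^+ 2)).
by rewrite /on_surface [X in X ^+ 2]addrAC subrr add0r S subrK.
Qed.

Lemma surface_le a b x y e : on_surface a b x y e ->
  a ^+ 2 <= x * y * ((x - 1) * (y - 1) - b).
Proof. by move=> <-; rewrite lerDr sqr_ge0. Qed.

Lemma surface_sym a b x y e : on_surface a b x y e -> on_surface a b y x e.
Proof. by rewrite /on_surface [y * x]mulrC [(y - 1) * _]mulrC. Qed.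

Lemma surfaceN a b x y e : on_surface a b x y e -> on_surface (- a) b x y e.
Proof. by rewrite /on_surface sqrrN. Qed.

End Surface.

(** * Isotropic frames *)

Section Frame.
Variables (R : realType) (V : vectType R[i]).
Variable h : {hermitian_sym V for Num.conj}.
Implicit Types (u v w : V) (s t x y k : R).

Definition isotropic_pair v1 v2 : Prop :=
  [/\ h v1 v1 = 0, h v2 v2 = 0 & h v1 v2 = 2^-1].

(** The curve of these points for s = 1 or s = -1 consists of the points of sign s
of the geodesic; a bending acts on it by multiplication of x. *)
Definition frame_point v1 v2 s x : V := (x^-1)%:C *: v1 + (s * x)%:C *: v2.

Lemma Re_divr (z : R[i]) (r : R) : complex.Re (z / r%:C) = complex.Re z / r.
Proof. by rewrite -fmorphV; case: z => a b /=; rewrite mulr0 subr0. Qed.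

Lemma Im_divr (z : R[i]) (r : R) : complex.Im (z / r%:C) = complex.Im z / r.
Proof. by rewrite -fmorphV; case: z => a b /=; rewrite mulr0 add0r. Qed.

Lemma half_real : 2^-1 = (2^-1 : R)%:C.
Proof. by rewrite fmorphV rmorph_nat. Qed.

Section Pair.
Variables v1 v2 : V.
Hypothesis pair : isotropic_pair v1 v2.
Local Notation frame_point := (frame_point v1 v2).

Lemma pair_v1 : h v1 v1 = 0. Proof. by case: pair. Qed.
Lemma pair_v2 : h v2 v2 = 0. Proof. by case: pair. Qed.
Lemma pair_v12 : h v1 v2 = (2^-1 : R)%:C.
Proof. by case: pair => _ _ ->; rewrite half_real. Qed.
Lemma pair_v21 : h v2 v1 = (2^-1 : R)%:C.
Proof. by rewrite herm_conj pair_v12 conjc_real. Qed.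

Lemma pair1_neq0 : v1 != 0.
Proof.
apply/eqP => v0; have := pair_v12; rewrite v0 linear0l => /esym/eqP.
by rewrite fmorph_eq0 invr_eq0 pnatr_eq0.
Qed.

Lemma pair2_neq0 : v2 != 0.
Proof.
apply/eqP => v0; have := pair_v12; rewrite v0 linear0r => /esym/eqP.
by rewrite fmorph_eq0 invr_eq0 pnatr_eq0.
Qed.

(** The factors 2 come from <v1, v2> = 1/2. *)
Definition pair_orth u : V := u + (- (2 * h u v2)) *: v1 + (- (2 * h u v1)) *: v2.

Lemma pair_orth1 u : h (pair_orth u) v1 = 0.
Proof.
rewrite /pair_orth !hE pair_v1 pair_v21 mulr0 addr0 -half_real.
by field; rewrite ?pnatr_eq0.
Qed.

Lemma pair_orth2 u : h (pair_orth u) v2 = 0.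
Proof.
rewrite /pair_orth !hE pair_v2 pair_v12 mulr0 addr0 -half_real.
by field; rewrite ?pnatr_eq0.
Qed.

Lemma pair_orthK u : u = pair_orth u + (2 * h u v2) *: v1 + (2 * h u v1) *: v2.
Proof. by rewrite /pair_orth !scaleNr [u - _ - _ + _]addrAC !subrK. Qed.

Lemma herm_frame_point s s' x y :
  h (frame_point s x) (frame_point s' y) = ((s' * y / x + s * x / y) / 2)%:C.
Proof.
rewrite !hE pair_v1 pair_v12 pair_v21 pair_v2 !mulr0 add0r addr0.
by rewrite -!rmorphM -rmorphD; congr _%:C; ring.
Qed.

Lemma hsq_frame_point s x : x != 0 -> hsq h (frame_point s x) = s.
Proof. by move=> x0; apply: complexI; rewrite -hsqE herm_frame_point; congr _%:C; field. Qed.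

Lemma frame_point_neq0 s x : s != 0 -> x != 0 -> frame_point s x != 0.
Proof.
move=> s0 x0; apply: contraNneq s0 => e.
by rewrite -(hsq_frame_point s x0) e /hsq linear0l.
Qed.

Variables (s1 s2 t k : R) (u : V).
Hypotheses (s1E : s1 ^+ 2 = 1) (s2E : s2 ^+ 2 = 1) (t0 : t != 0) (k0 : k != 0).
Hypothesis u0 : hsq h u != 0.
Let A := k ^+ 2 * normsq (h u v2).
Let B := normsq (h u v1) / k ^+ 2.
Let K := complex.Re (h u v1 * Num.conj (h u v2)).
Let M := complex.Im (h u v1 * Num.conj (h u v2)).

(** The factor k is the effect of a bending, here moved from the first two points to
the products of u with v1 and v2. *)
Lemma frame_invariants :
  [/\ tance h (frame_point s1 k) (frame_point s2 (t * k)) = frame_tance12 s1 s2 t,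
      tance h (frame_point s2 (t * k)) u = frame_tance23 s2 t (hsq h u) A B K,
      tance h u (frame_point s1 k) = frame_tance31 s1 (hsq h u) A B K,
      complex.Re (eta h (frame_point s1 k) (frame_point s2 (t * k)) u) =
        frame_re_eta s1 s2 t (hsq h u) A B K
    & complex.Im (eta h (frame_point s1 k) (frame_point s2 (t * k)) u) =
        frame_alpha s1 s2 t (hsq h u) M].
Proof.
have tk0 : t * k != 0 by rewrite mulf_neq0.
have h2u : h (frame_point s2 (t * k)) u = ((t * k)^-1)%:C * Num.conj (h u v1) +
    (s2 * (t * k))%:C * Num.conj (h u v2) by rewrite !hE -!herm_conj.
have hu1 : h u (frame_point s1 k) = (k^-1)%:C * h u v1 + (s1 * k)%:C * h u v2.
  by rewrite !hE.
rewrite /eta /tance !hsqE !hsq_frame_point // herm_frame_point h2u hu1 -!rmorphM Re_divr Im_divr.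
rewrite /A /B /K /M; clear h2u hu1 A B K M.
move: (hsq h u) u0 (h u v1) (h u v2) => G G0 [a1 a2] [b1 b2].
rewrite /normsq /frame_tance12 /frame_tance23 /frame_tance31 /frame_re_eta /frame_alpha /=.
case: (sign_cases s1E) (sign_cases s2E) => -> [] ->;
  by split; field; rewrite ?G0 ?t0 ?k0.
Qed.

End Pair.

End Frame.

(** * The bending operators *)

Section Bending.
Variables (R : realType) (V : vectType R[i]).
Variable h : {hermitian_sym V for Num.conj}.
Implicit Types (u v w : V) (s t x y k : R) (p q : {vspace V}).

Lemma lfun_det_diag (e : (\dim {:V}).-tuple V) (d : nat -> R[i]) (f : 'End(V)) :
  basis_of {:V} e -> (forall i : 'I_(\dim {:V}), f e`_i = d i *: e`_i) ->
  lfun_det f = \prod_(i < \dim {:V}) d i.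
Proof.
move=> bas fd; set b := vbasis {:V}; have basb : basis_of {:V} b := vbasisP _.
have <- : \det (passmx.mxof e e f) = \prod_(i < \dim {:V}) d i.
  rewrite (_ : passmx.mxof e e f = diag_mx (\row_i d i)).
    by rewrite det_diag; apply: eq_bigr => i _; rewrite mxE.
  apply/matrixP => i j; rewrite !mxE /= passmx.vecof_delta fd linearZ /=.
  by rewrite coord_free ?(basis_free bas) // mulr_natr.
have ff : f = (\1 \o (f \o \1))%VF.
  by apply/lfunP => v; rewrite !comp_lfunE !id_lfunE.
rewrite [in RHS]ff (passmx.mxof_comp e e basb) (passmx.mxof_comp e b basb).
rewrite !det_mulmx mulrAC -det_mulmx -(passmx.mxof_comp e e basb).
rewrite (_ : (\1 \o \1)%VF = \1%VF :> 'End(V)).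
  by rewrite passmx.mxof1 ?(basis_free bas) // det1 mul1r.
by apply/lfunP => v; rewrite comp_lfunE !id_lfunE.
Qed.

Section Op.
Variables (v1 v2 : V).
Hypothesis pair : isotropic_pair h v1 v2.
Local Notation frame_point := (frame_point v1 v2).

Lemma lincomb_lincomb (a b c d e f : R[i]) :
  a *: (b *: v1 + c *: v2) + d *: (e *: v1 + f *: v2) =
  (a * b + d * e) *: v1 + (a * c + d * f) *: v2.
Proof. by rewrite !scalerDr !scalerA addrACA -!scalerDl. Qed.

Lemma frame_point_basis s s' x y : x != 0 -> y != 0 -> s' * y / x - s * x / y != 0 ->
  let D := s' * y / x - s * x / y in
  v1 = (s' * y / D)%:C *: frame_point s x + (- (s * x) / D)%:C *: frame_point s' y /\
  v2 = (- y^-1 / D)%:C *: frame_point s x + (x^-1 / D)%:C *: frame_point s' y.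
Proof.
move=> x0 y0 D0 D; rewrite /frame_point !lincomb_lincomb -!rmorphM -!rmorphD.
have E1 : s' * y / D * x^-1 + - (s * x) / D * y^-1 = 1.
  transitivity (D / D); last by rewrite divff.
  by rewrite {3}/D; ring.
have E2 : s' * y / D * (s * x) + - (s * x) / D * (s' * y) = 0 by ring.
have E3 : - y^-1 / D * x^-1 + x^-1 / D * y^-1 = 0 by ring.
have E4 : - y^-1 / D * (s * x) + x^-1 / D * (s' * y) = 1.
  transitivity (D / D); last by rewrite divff.
  by rewrite {3}/D; ring.
by rewrite E1 E2 E3 E4 !scale0r !scale1r addr0 add0r.
Qed.

Lemma frame_point_span s s' x y : x != 0 -> y != 0 -> s' * y / x - s * x / y != 0 ->
  (<[frame_point s x]> + <[frame_point s' y]> = <[v1]> + <[v2]>)%VS.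
Proof.
move=> x0 y0 /(frame_point_basis x0 y0) [E1 E2].
have m z z' w w' : z *: w + z' *: w' \in (<[w]> + <[w']>)%VS.
  by rewrite memv_add // memvZ // memv_line.
apply/eqP; rewrite eqEsubv !subv_add -!memvE !m /=.
by rewrite [X in X \in _]E1 [X in _ && (X \in _)]E2 !m.
Qed.

Lemma pair_free : free [:: v1; v2].
Proof.
rewrite free_cons span_seq1 seq1_free (pair2_neq0 pair) andbT.
apply/negP => /vlineP [c v1E]; have := pair_v12 pair.
rewrite v1E hZl (pair_v2 pair) mulr0 => /esym/eqP.
by rewrite fmorph_eq0 invr_eq0 pnatr_eq0.
Qed.

Lemma pair_dim : \dim (<[v1]> + <[v2]>) = 2%N.
Proof. by have := pair_free; rewrite /free span_cons span_seq1 => /eqP. Qed.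

(** The points with parameter x = 1 and opposite signs are orthogonal. *)
Lemma pair_signature : has_signature h (<[v1]> + <[v2]>)%VS [:: 1; -1].
Proof.
have [n1 d0] : (1 : R) != 0 /\ -1 * 1 / 1 - 1 * 1 / 1 != 0 :> R.
  by rewrite oner_eq0; split=> //; rewrite !mulr1 invr1 !mulr1 -opprD oppr_eq0 pnatr_eq0.
exists [tuple frame_point 1 1; frame_point (-1) 1]; split=> /=.
- rewrite basisEdim pair_dim andbT span_cons span_seq1.
  by rewrite (frame_point_span n1 n1 d0).
- case=> [[|[|[|i]]] ?] [[|[|[|j]]] ?] //= _;
  by rewrite (herm_frame_point pair) !mulr1 invr1 !mulr1 ?subrr ?addNr mul0r.
- by case=> [[|[|i]] ?] //=; rewrite hsqE (hsq_frame_point pair) // sgz_complex ?sgz1 ?sgzN1.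
Qed.

(** The coordinates of u along v1 and v2 are 2 <u, v2> and 2 <u, v1>. *)
Definition bendop k u : V := u + ((2 * (k^-1 - 1))%:C * h u v2) *: v1
                               + ((2 * (k - 1))%:C * h u v1) *: v2.

Lemma bendop_linear k : linear (bendop k).
Proof.
move=> c u v; rewrite /bendop !hDl !hZl !scalerDr !scalerA.
have E (p q r t : R[i]) (x y : V) : x + p *: v1 + q *: v2 + (y + r *: v1 + t *: v2) =
    x + y + (p + r) *: v1 + (q + t) *: v2.
  by rewrite !scalerDl addrACA [x + _ + _]addrACA.
by rewrite E; congr (_ + _ *: _ + _ *: _); ring.
Qed.
HB.instance Definition _ k :=
  GRing.isSemilinear.Build R[i] V V _ (bendop k)
    (GRing.semilinear_linear (bendop_linear k)).

Lemma bendop_v1 k : bendop k v1 = (k^-1)%:C *: v1.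
Proof.
rewrite /bendop (pair_v1 pair) (pair_v12 pair) mulr0 scale0r addr0 -rmorphM.
rewrite -{1}[v1]scale1r -scalerDl -(rmorph1 (real_complex R)) -rmorphD.
by congr (_%:C *: _); move: k^-1 => l; field.
Qed.

Lemma bendop_v2 k : bendop k v2 = k%:C *: v2.
Proof.
rewrite /bendop (pair_v2 pair) (pair_v21 pair) mulr0 scale0r addr0 -rmorphM.
rewrite -{1}[v2]scale1r -scalerDl -(rmorph1 (real_complex R)) -rmorphD.
by congr (_%:C *: _); field.
Qed.

Lemma bendop_orth k u : h u v1 = 0 -> h u v2 = 0 -> bendop k u = u.
Proof. by rewrite /bendop => -> ->; rewrite !mulr0 !scale0r !addr0. Qed.

Lemma bendop1 u : bendop 1 u = u.
Proof. by rewrite /bendop invr1 subrr mulr0 !mul0r !scale0r !addr0. Qed.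

Lemma pair_herm_bendop k u : k != 0 ->
  h (bendop k u) v1 = k%:C * h u v1 /\ h (bendop k u) v2 = (k^-1)%:C * h u v2.
Proof.
move=> k0; rewrite /bendop !hE (pair_v1 pair) (pair_v12 pair) (pair_v21 pair) (pair_v2 pair).
by split; field; rewrite fmorph_eq0.
Qed.

Lemma bendop_comp k l u : k != 0 -> l != 0 ->
  bendop k (bendop l u) = bendop (k * l) u.
Proof.
move=> k0 l0.
have E (a b c d : R[i]) : u + a *: v1 + b *: v2 + c *: v1 + d *: v2 =
    u + (a + c) *: v1 + (b + d) *: v2.
  by rewrite !scalerDl !addrA; congr (_ + _); rewrite addrAC.
rewrite {2}/bendop !linearD !linearZ /= bendop_v1 bendop_v2 !scalerA {1}/bendop.
by rewrite E /bendop; congr (_ + _ *: _ + _ *: _); field; rewrite ?fmorph_eq0 ?k0 ?l0.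
Qed.

Lemma bendop_isometry k u v : k != 0 -> h (bendop k u) (bendop k v) = h u v.
Proof.
move=> k0; have [E1 E2] := pair_herm_bendop u k0.
rewrite {2}/bendop !hDr !hZr E1 E2 {1}/bendop !hDl !hZl !rmorphM /= !conjc_real.
by rewrite -!herm_conj; field; rewrite ?fmorph_eq0 ?k0.
Qed.

Lemma bendop_frame_point k s x : k != 0 -> x != 0 ->
  bendop k (frame_point s x) = frame_point s (x * k).
Proof.
move=> k0 x0; rewrite /frame_point linearD !linearZ /= bendop_v1 bendop_v2 !scalerA.
by rewrite -!rmorphM; congr (_%:C *: _ + _%:C *: _); field; rewrite ?k0 ?x0.
Qed.

Lemma bendop_det k : \dim {:V} = 3%N -> k != 0 ->
  lfun_det (linfun (bendop k)) = 1.
Proof.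
move=> dimV k0; have [w wU] : exists w, w \notin (<[v1]> + <[v2]>)%VS.
  by apply: exists_notin; rewrite pair_dim dimV.
pose n := pair_orth h v1 v2 w.
have m1 : v1 \in (<[v1]> + <[v2]>)%VS by rewrite memvE addvSl.
have m2 : v2 \in (<[v1]> + <[v2]>)%VS by rewrite memvE addvSr.
have nU : n \notin (<[v1]> + <[v2]>)%VS.
  apply: contra wU => nU; rewrite (pair_orthK h v1 v2 w).
  by apply: memvD; first apply: memvD => //; exact: memvZ.
have n1 : h n v1 = 0 := pair_orth1 pair w.
have n2 : h n v2 = 0 := pair_orth2 pair w.
have sz : size [:: n; v1; v2] == \dim {:V} by rewrite dimV.
have bas : basis_of {:V} (Tuple sz).
  rewrite basisEfree subvf (eqP sz) leqnn !andbT /= free_cons pair_free andbT.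
  by rewrite span_cons span_seq1.
rewrite (lfun_det_diag (d := nth 1 [:: 1; (k^-1)%:C; k%:C]) bas).
  rewrite -(big_mkord xpredT (fun i => nth 1 [:: 1; (k^-1)%:C; k%:C] i)) dimV.
  by rewrite !big_nat_recl // big_geq //= mul1r mulr1 -rmorphM mulVf.
move=> i; rewrite lfunE /=; have := ltn_ord i; rewrite {2}dimV.
case: i => [[|[|[|i]]] ?] //= _; rewrite ?bendop_v1 ?bendop_v2 //.
by rewrite bendop_orth // scale1r.
Qed.

End Op.
End Bending.

(** * Invariants under a bending involving the first two points *)

Section Points.
Variables (R : realType) (V : vectType R[i]).
Variable h : {hermitian_sym V for Num.conj}.
Implicit Types (u v w : V) (s t x y k : R) (p q : {vspace V}).

Definition psign p : R := Num.sg (hsq h (rep p)).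

Lemma herm_hsq p : herm h p p = (hsq h (rep p))%:C.
Proof. exact: hsqE. Qed.

Lemma sigmaE p : sigma h p = sgz (psign p).
Proof. by rewrite /sigma herm_hsq sgz_complex /psign sgz_sgr. Qed.

Lemma sigma_intr p : (sigma h p)%:~R = (psign p)%:C :> R[i].
Proof. by rewrite /psign sgrEz rmorph_int sigmaE /psign sgz_sgr. Qed.

Lemma isotropicE p : isotropic h p = (psign p == 0).
Proof. by rewrite /isotropic herm_hsq fmorph_eq0 sgr_eq0. Qed.

Lemma negativeE p : negative h p = (psign p < 0).
Proof. by rewrite /negative herm_hsq ltcR sgr_lt0. Qed.

Lemma positiveE p : positive h p = (0 < psign p).
Proof. by rewrite /positive herm_hsq ltcR sgr_gt0. Qed.

Lemma psign_sqr p : ~~ isotropic h p -> psign p ^+ 2 = 1.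
Proof. by rewrite isotropicE /psign sgr_eq0 => n0; rewrite sqr_sg n0. Qed.

Lemma psign_neq0 p : ~~ isotropic h p -> psign p != 0.
Proof. by rewrite isotropicE. Qed.

Lemma psign_line u : u != 0 -> psign <[u]>%VS = Num.sg (hsq h u).
Proof.
move=> /(hsq_line h) [c c0]; rewrite herm_hsq /psign => /complexI ->.
by rewrite sgrM (gtr0_sg c0) mul1r.
Qed.

Lemma hsq_rep_neq0 p : ~~ isotropic h p -> hsq h (rep p) != 0.
Proof. by rewrite /isotropic herm_hsq fmorph_eq0. Qed.

Lemma ptance_eq0 p q : ~~ isotropic h p -> ~~ isotropic h q ->
  (ptance h p q == 0) = orthogonal_points h p q.
Proof.
move=> /hsq_rep_neq0 p0 /hsq_rep_neq0 q0.
rewrite /ptance /tance mulf_eq0 invr_eq0 mulf_eq0 (negPf p0) (negPf q0) !orbF.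
by rewrite normsq_eq0.
Qed.

Lemma ptanceC p q : ptance h p q = ptance h q p.
Proof. exact: tanceC. Qed.

Lemma ptance_sign p q : ~~ isotropic h p -> ~~ isotropic h q ->
  ~~ orthogonal_points h p q -> 0 < psign p * psign q * ptance h p q.
Proof.
move=> /hsq_rep_neq0 p0 /hsq_rep_neq0 q0 o.
have N : 0 < normsq (herm h p q) by rewrite normsq_gt0.
have E (x : R) : x != 0 -> Num.sg x / x = `|x|^-1.
  by move=> x0; rewrite {2}[x]numEsg invfM mulrA divff ?sgr_eq0 // mul1r.
rewrite /ptance /tance -/(herm h p q) invfM.
rewrite (_ : _ * _ = (psign p / hsq h (rep p)) * (psign q / hsq h (rep q)) *
  normsq (herm h p q)); last by ring.
by rewrite !E // !mulr_gt0 // invr_gt0 normr_gt0.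
Qed.

Lemma orthogonal_sym p q : orthogonal_points h p q = orthogonal_points h q p.
Proof. by rewrite /orthogonal_points /herm herm_conj conjC_eq0. Qed.

Definition pgram p1 p2 p3 : R :=
  gram_det (ptance h p1 p2) (ptance h p2 p3) (ptance h p3 p1)
           (complex.Re (peta h p1 p2 p3)).

Lemma beta_pgram p1 p2 p3 :
  ~~ isotropic h p1 -> ~~ isotropic h p2 -> ~~ isotropic h p3 ->
  beta h p1 p2 p3 = (pgram p1 p2 p3)%:C.
Proof. exact: betaE. Qed.

(** |eta|^2 = x y z with z eliminated by means of the Gram determinant. *)
Lemma gram_surface p1 p2 p3 :
  ~~ isotropic h p1 -> ~~ isotropic h p2 -> ~~ isotropic h p3 ->
  on_surface (alpha h p1 p2 p3) (pgram p1 p2 p3) (ptance h p1 p2) (ptance h p2 p3)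
    (complex.Re (peta h p1 p2 p3)).
Proof.
move=> /hsq_rep_neq0 n1 /hsq_rep_neq0 n2 /hsq_rep_neq0 n3.
have := eta_normsq n1 n2 n3; rewrite -/(peta h p1 p2 p3) -!/(ptance h _ _).
rewrite alphaE /pgram /on_surface /gram_det /normsq.
set e := complex.Re _; set a := complex.Im _.
set x := ptance h p1 p2; set y := ptance h p2 p3; set z := ptance h p3 p1 => E.
have -> : (e - x * y) ^+ 2 + a ^+ 2 = (e ^+ 2 + a ^+ 2) - 2 * e * x * y + (x * y) ^+ 2.
  by ring.
by rewrite E; ring.
Qed.

Lemma bending_frame_points p1 p2 v1 v2 a : bending_frame h p1 p2 v1 v2 a ->
  [/\ isotropic_pair h v1 v2, a != 0,
      p1 = <[frame_point v1 v2 (psign p1) 1]>%VS &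
      p2 = <[frame_point v1 v2 (psign p2) (expR a)]>%VS].
Proof.
move=> [[_ v11 _] [_ v22 _] v12 a0 [E1 E2]]; split => //.
  by rewrite {1}E1 /frame_point sigma_intr invr1 mulr1 scale1r.
by rewrite {1}E2 /frame_point sigma_intr rmorphM expRN.
Qed.

Lemma is_bending_points p1 p2 B : is_bending h p1 p2 B ->
  exists v1 v2 a,
  [/\ isotropic_pair h v1 v2, a != 0,
      p1 = <[frame_point v1 v2 (psign p1) 1]>%VS,
      p2 = <[frame_point v1 v2 (psign p2) (expR a)]>%VS &
      forall s e x, x != 0 ->
        B s (frame_point v1 v2 e x) = frame_point v1 v2 e (x * expR (a * s))].
Proof.
move=> [_ _ _ [v1 [v2 [a [/bending_frame_points [pair a0 E1 E2] BE]]]]].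
exists v1, v2, a; split => // s e x x0; have [b1 b2 _] := BE s.
rewrite /frame_point linearD !linearZ /= b1 b2 !scalerA -!rmorphM.
have n0 : expR (a * s) != 0 by rewrite gt_eqF // expR_gt0.
congr (_%:C *: _ + _%:C *: _); last by rewrite mulrA.
by rewrite mulNr expRN invfM.
Qed.

Lemma psign_frame_point v1 v2 p x : isotropic_pair h v1 v2 ->
  ~~ isotropic h p -> x != 0 ->
  psign <[frame_point v1 v2 (psign p) x]>%VS = psign p.
Proof.
move=> pair n x0; rewrite psign_line ?(frame_point_neq0 pair) ?psign_neq0 //.
by rewrite (hsq_frame_point pair) // /psign sgr_id.
Qed.

(** The product <p1, p2> is (s2 t + s1 / t) / 2 up to rescaling. *)
Lemma frame_nonorthogonal v1 v2 p1 p2 t : isotropic_pair h v1 v2 ->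
  ~~ isotropic h p1 -> ~~ isotropic h p2 -> t != 0 -> ~~ orthogonal_points h p1 p2 ->
  p1 = <[frame_point v1 v2 (psign p1) 1]>%VS ->
  p2 = <[frame_point v1 v2 (psign p2) t]>%VS ->
  t ^+ 2 + psign p1 * psign p2 != 0.
Proof.
move=> pair n1 n2 t0 + E1 E2; rewrite {1}E1 {1}E2.
rewrite orthogonal_lineE ?(frame_point_neq0 pair) ?psign_neq0 ?oner_eq0 //.
rewrite (herm_frame_point pair) fmorph_eq0; apply: contra => /eqP E.
move: (psign_sqr n2) E => /sign_cases [] -> E; rewrite divr1 !mulr1 in E *.
  rewrite (_ : _ / 2 = (t ^+ 2 + psign p1) / t / 2); last by field.
  by rewrite E !mul0r.
rewrite (_ : _ / 2 = - (t ^+ 2 + psign p1 * -1) / t / 2); last by field.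
by rewrite E oppr0 !mul0r.
Qed.

(** The condition a <> 0 in a frame says that the two points are independent: their
coordinates have determinant s2 t - s1 / t with t = e^a. *)
Lemma frame_distinct (a s1 s2 : R) : a != 0 -> s1 ^+ 2 = 1 -> s2 ^+ 2 = 1 ->
  expR a ^+ 2 - s1 * s2 != 0.
Proof.
move=> a0 s1E s2E; have p : 0 < expR a by exact: expR_gt0.
have e1 : (s1 * s2) ^+ 2 = 1 by rewrite exprMn s1E s2E mulr1.
case/sign_cases: e1 => ->; last first.
  by rewrite opprK lt0r_neq0 // (addr_gt0 (exprn_gt0 2 p) ltr01).
rewrite subr_eq0 sqrf_eq1 negb_or; apply/andP; split.
  by rewrite -[X in _ != X]expR0 (inj_eq (@expR_inj R)).
by rewrite gt_eqF // (lt_trans _ p) // oppr_lt0 ltr01.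
Qed.

Lemma bend12_invariants p1 p2 p3 q1 q2 q3 : is_point p3 ->
  ~~ isotropic h p1 -> ~~ isotropic h p2 -> ~~ isotropic h p3 ->
  bend12 h (p1, p2, p3) (q1, q2, q3) ->
  [/\ q3 = p3, is_point q1 /\ is_point q2,
      psign q1 = psign p1 /\ psign q2 = psign p2,
      [/\ ptance h q1 q2 = ptance h p1 p2, alpha h q1 q2 q3 = alpha h p1 p2 p3 &
          pgram q1 q2 q3 = pgram p1 p2 p3]
    & (q1 + q2)%VS = (p1 + p2)%VS].
Proof.
move=> /point_rep [+ +] n1 n2 n3 [B [s [bend [-> -> ->]]]].
move: (rep p3) => u u0 E3.
have nonorth : ~~ orthogonal_points h p1 p2 by case: bend => -[].
have [v1 [v2 [a [pair a0 E1 E2 BE]]]] := is_bending_points bend.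
have t0 : expR a != 0 by rewrite gt_eqF // expR_gt0.
have k0 : expR (a * s) != 0 by rewrite gt_eqF // expR_gt0.
set t := expR a in t0 E2 *; set k := expR (a * s) in k0.
have o0 : (1 : R) != 0 by rewrite oner_eq0.
set s1 := psign p1 in E1 *; set s2 := psign p2 in E2 *.
have F1 : (B s @: p1)%VS = <[frame_point v1 v2 s1 k]>%VS.
  by rewrite {1}E1 limg_line BE // mul1r.
have F2 : (B s @: p2)%VS = <[frame_point v1 v2 s2 (t * k)]>%VS.
  by rewrite {1}E2 limg_line BE.
have s10 : s1 != 0 by exact: psign_neq0.
have s20 : s2 != 0 by exact: psign_neq0.
have tk0 : t * k != 0 by rewrite mulf_neq0.
have s1E : s1 ^+ 2 = 1 by exact: psign_sqr.
have s2E : s2 ^+ 2 = 1 by exact: psign_sqr.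
have G0 : hsq h u != 0 by rewrite E3 isotropic_lineE in n3.
have hn e x : e != 0 -> x != 0 -> frame_point v1 v2 e x != 0.
  by move=> e0 x0; exact: (frame_point_neq0 pair e0 x0).
rewrite F1 F2; split => //.
- by split; apply: line_point; apply: hn.
- by rewrite !psign_frame_point.
- have [i1 i2 i3 i4 i5] := frame_invariants pair s1E s2E t0 k0 G0.
  have := frame_invariants pair s1E s2E t0 o0 G0; rewrite mulr1.
  move=> [j1 j2 j3 j4 j5].
  rewrite /pgram !alphaE E1 E2 E3 !ptance_lineE ?peta_lineE ?hn //.
  by rewrite i1 i2 i3 i4 i5 j1 j2 j3 j4 j5 !gram_detE.
have d0 := frame_distinct a0 s1E s2E.
have dk x : x != 0 -> s2 * (t * x) / x - s1 * x / (t * x) != 0.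
  move=> x0; rewrite (_ : _ - _ = s2 / t * (t ^+ 2 - s1 * s2)).
    by rewrite !mulf_neq0 ?invr_eq0.
  by case: (sign_cases s2E) => ->; field; rewrite t0 x0.
have dk1 := dk 1 o0; rewrite [t * 1]mulr1 in dk1.
by rewrite (frame_point_span v1 v2 k0 tk0 (dk _ k0)) E1 E2 (frame_point_span v1 v2 o0 t0 dk1).
Qed.

End Points.

(** * Bendings preserve strong regularity; existence of bendings *)

Section Deform.
Variables (R : realType) (V : vectType R[i]).
Variable h : {hermitian_sym V for Num.conj}.
Hypothesis dimV : \dim {:V} = 3%N.
Hypothesis sigV : has_signature h {:V}%VS [:: 1; 1; -1].
Implicit Types (u v w : V) (s t x y k : R) (p q : {vspace V}).
Local Notation psign := (psign h).
Local Notation ptance := (ptance h).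

Lemma negative_nonorthogonal p q : is_point p -> negative h p -> negative h q ->
  ~~ orthogonal_points h p q.
Proof.
move=> /point_rep [r0 _]; rewrite /negative !herm_hsq !ltcR => np nq.
apply/negP => /eqP o; have := orth_negative sigV nq o r0.
by move/(lt_trans np); rewrite ltxx.
Qed.

Lemma strongly_regular_bend12 p1 p2 p3 q1 q2 q3 :
  strongly_regular h p1 p2 p3 -> bend12 h (p1, p2, p3) (q1, q2, q3) ->
  strongly_regular h q1 q2 q3.
Proof.
move=> /(strongly_regularP h dimV) [[pt1 pt2 pt3] [n1 n2 n3] [nz21 nz23] cnt [full al]].
move=> /(bend12_invariants pt3 n1 n2 n3) [-> [qt1 qt2] [s1 s2] [x12 aq _] sum].
have m1 : ~~ isotropic h q1 by rewrite isotropicE s1 -isotropicE.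
have m2 : ~~ isotropic h q2 by rewrite isotropicE s2 -isotropicE.
apply/(strongly_regularP h dimV); split => //.
- split.
    by rewrite -ptance_eq0 // ptanceC x12 ptanceC ptance_eq0.
  have [a0|a0] := eqVneq (alpha h p1 p2 p3) 0.
    have [_ neg2 neg3] := al a0.
    by apply: negative_nonorthogonal => //; rewrite negativeE s2 -negativeE.
  apply: contra a0 => /eqP h23; rewrite -aq /alpha h23 mulr0 !mul0r.
  by rewrite raddf0.
- by move: cnt; rewrite /= !positiveE s1 s2.
- split; first by rewrite sum.
  by rewrite aq => /al []; rewrite !negativeE s1 s2.
Qed.

Lemma ptance_hyperbolic p1 p2 p3 : strongly_regular h p1 p2 p3 ->
  0 < ptance p1 p2 * (ptance p1 p2 - 1).
Proof.
move=> /(strongly_regularP h dimV) [[pt1 pt2 pt3] [n1 n2 n3] [nz21 nz23] cnt [full _]].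
have [r1 E1] := point_rep pt1; have [r2 E2] := point_rep pt2.
apply: (tance_hyperbolic sigV) => //; try exact: hsq_rep_neq0.
- have [lt1|ge1] := ltP (hsq h (rep p1)) 0; first by left.
  have [lt2|ge2] := ltP (hsq h (rep p2)) 0; first by right.
  have pos p : ~~ isotropic h p -> 0 <= hsq h (rep p) -> positive h p.
    by move=> /hsq_rep_neq0 n ge; rewrite /positive herm_hsq ltcR lt_def n.
  by move: cnt; rewrite /= (pos p1) ?(pos p2) //; case: (positive h p3).
- by rewrite -/(herm h p1 p2) -/(orthogonal_points h p1 p2) orthogonal_sym.
rewrite -E2; apply/negP => mem; have p12 : (p1 <= p2)%VS by rewrite E1 -memvE.
have: (fullv <= p2 + p3)%VS.
  by rewrite -full subv_add addvSr andbT subv_add addvSl andbT (subv_trans p12) ?addvSl.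
move/dimvS/leq_trans => /(_ _ (dimv_add_leqif p2 p3)).
by rewrite dimV pt2 pt3.
Qed.

(** The parameter t solves s2 t + s1 / t = 2 s2 g; the larger root g + r is taken, so
that t > 0. Then v1 and v2 are found by inverting the linear system that
expresses u1 and u2 by them. *)
Lemma frame_of_gram (u1 u2 : V) (s1 s2 g : R) :
  s1 ^+ 2 = 1 -> s2 ^+ 2 = 1 -> hsq h u1 = s1 -> hsq h u2 = s2 ->
  h u1 u2 = (s2 * g)%:C -> 0 < g -> 0 < g ^+ 2 - s1 * s2 ->
  exists v1 v2 t x1 x2 y1 y2, [/\ isotropic_pair h v1 v2,
    (0 < t /\ t != 1),
    u1 = frame_point v1 v2 s1 1 /\ u2 = frame_point v1 v2 s2 t &
    v1 = (x1 : R)%:C *: u1 + (x2 : R)%:C *: u2 /\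
    v2 = (y1 : R)%:C *: u1 + (y2 : R)%:C *: u2].
Proof.
move=> s1E s2E h1 h2 h12 g0 g2.
pose r := Num.sqrt (g ^+ 2 - s1 * s2); pose t := g + r.
have r0 : 0 < r by rewrite sqrtr_gt0.
have rE : r ^+ 2 = g ^+ 2 - s1 * s2 by rewrite sqr_sqrtr // ltW.
have t0 : 0 < t by rewrite addr_gt0.
have tn0 : t != 0 by rewrite gt_eqF.
have tE : t ^+ 2 - 2 * g * t + s1 * s2 = 0.
  by rewrite -[s1 * s2](subKr (g ^+ 2)) -rE /t; ring.
have gE : g = (t + s1 * s2 / t) / 2.
  apply/eqP; rewrite -subr_eq0; apply/eqP.
  transitivity (- (t ^+ 2 - 2 * g * t + s1 * s2) / t / 2); first by field.
  by rewrite tE oppr0 !mul0r.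
have rt : r = t - g by rewrite /t addrC addKr.
pose D := s2 * t - s1 / t; have Dt : D = s2 * t - s1 / t by [].
clearbody D t r.
have s20 : s2 != 0 by rewrite -sqrf_eq0 s2E oner_eq0.
have DE : D = 2 * s2 * r.
  apply/eqP; rewrite -subr_eq0; apply/eqP.
  transitivity (- s2 / t * (t ^+ 2 - 2 * g * t + s1 * s2)); last by rewrite tE mulr0.
  by rewrite rt Dt; case: (sign_cases s2E) => ->; field.
have D0 : D != 0 by rewrite DE !mulf_neq0 ?pnatr_eq0 // gt_eqF.
have DD : D ^+ 2 = 4 * (g ^+ 2 - s1 * s2).
  by rewrite DE -rE !exprMn s2E; ring.
pose v1 := (s2 * t / D)%:C *: u1 + (- s1 / D)%:C *: u2.
pose v2 := (- t^-1 / D)%:C *: u1 + (D^-1)%:C *: u2.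
have h21 : h u2 u1 = (s2 * g)%:C by rewrite herm_conj h12 conjc_real.
have hv a b c d : h (a%:C *: u1 + b%:C *: u2) (c%:C *: u1 + d%:C *: u2) =
    (a * c * s1 + (a * d + b * c) * (s2 * g) + b * d * s2)%:C.
  rewrite !hE !hsqE h1 h2 h12 h21 -!rmorphM -!rmorphD -!rmorphM -!rmorphD.
  by congr _%:C; ring.
exists v1, v2, t, (s2 * t / D), (- s1 / D), (- t^-1 / D), D^-1; split=> //.
- rewrite /isotropic_pair half_real !hv; split.
  + rewrite (_ : _ + _ = s1 / D ^+ 2 * (t ^+ 2 - 2 * g * t + s1 * s2)).
      by rewrite tE mulr0.
    by case: (sign_cases s1E) (sign_cases s2E) => -> [] ->; field; rewrite ?tn0 ?D0.
  + rewrite (_ : _ + _ = s2 / D ^+ 2 / t ^+ 2 * (t ^+ 2 - 2 * g * t + s1 * s2)).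
      by rewrite tE mulr0.
    by case: (sign_cases s1E) (sign_cases s2E) => -> [] ->; field; rewrite tn0 D0.
  + congr _%:C; transitivity ((t + s1 * s2 / t - 2 * g) * g / D ^+ 2 +
        2 * (g ^+ 2 - s1 * s2) / D ^+ 2).
      by case: (sign_cases s1E) (sign_cases s2E) => -> [] ->; field; rewrite tn0 D0.
    rewrite {1}gE (_ : t + _ - _ = 0); last by field.
    by rewrite !mul0r add0r DD; field; rewrite gt_eqF.
- split=> //; apply: contraNneq D0 => t1.
  have e1 : (s1 * s2) ^+ 2 = 1 by rewrite exprMn s1E s2E mulr1.
  rewrite Dt t1 divr1 mulr1 subr_eq0.
  have := gE; rewrite t1 divr1.
  case: (sign_cases s1E) (sign_cases s2E) => -> [] -> //;
  by rewrite ?mulrN1 ?mulN1r ?mul1r ?opprK ?subrr ?mul0r => ge; rewrite ge ltxx in g0.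
- split; rewrite /frame_point /v1 /v2 lincomb_lincomb -!rmorphM -!rmorphD.
    have E1 : 1^-1 * (s2 * t / D) + s1 * 1 * (- t^-1 / D) = 1.
      by rewrite invr1 mul1r mulr1; transitivity ((s2 * t - s1 / t) / D); [ring|rewrite -Dt divff].
    have E2 : 1^-1 * (- s1 / D) + s1 * 1 * D^-1 = 0 by rewrite invr1; ring.
    by rewrite E1 E2 scale0r scale1r addr0.
  have E1 : t^-1 * (s2 * t / D) + s2 * t * (- t^-1 / D) = 0 by field; rewrite tn0 D0.
  have E2 : t^-1 * (- s1 / D) + s2 * t * D^-1 = 1.
    by transitivity ((s2 * t - s1 / t) / D); [ring|rewrite -Dt divff].
  by rewrite E1 E2 scale0r scale1r add0r.
Qed.

End Deform.

Section Existence.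
Variables (R : realType) (V : vectType R[i]).
Variable h : {hermitian_sym V for Num.conj}.
Hypothesis dimV : \dim {:V} = 3%N.
Implicit Types (u v w : V) (s t x y k : R) (p q : {vspace V}).
Local Notation psign := (psign h).
Local Notation ptance := (ptance h).

Lemma normsq_real (x : R) : normsq (x%:C) = x ^+ 2.
Proof. by rewrite /normsq /= expr0n addr0. Qed.

Lemma real_span2 (u v : V) (x y : R) :
  real_span [tuple u; v] (x%:C *: u + y%:C *: v).
Proof.
by exists (fun i => nth 0 [:: x; y] i); rewrite !big_ord_recl big_ord0 addr0.
Qed.

(** Normalize the representatives u1 of p1 and u2 of p2 to squares 1 or -1, keeping
them in the real subspace that defines the geodesic, with a real product whose
sign is that of p2. *)
Lemma bending_frame_exists p1 p2 : is_point p1 -> is_point p2 ->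
  ~~ isotropic h p1 -> ~~ isotropic h p2 -> ~~ orthogonal_points h p1 p2 ->
  0 < ptance p1 p2 * (ptance p1 p2 - 1) ->
  exists v1 v2 a, bending_frame h p1 p2 v1 v2 a.
Proof.
move=> pt1 pt2 n1 n2 o12 hyper.
have [P10 E1] := point_rep pt1; have [P20 E2] := point_rep pt2.
set P1 := rep p1 in E1 P10; set P2 := rep p2 in E2 P20; set c := herm h p1 p2.
have c0 : c != 0 by [].
have H10 : hsq h P1 != 0 by exact: hsq_rep_neq0.
have H20 : hsq h P2 != 0 by exact: hsq_rep_neq0.
have s1E := psign_sqr n1; have s2E := psign_sqr n2.
pose r1 := Num.sqrt `|hsq h P1|; pose r2 := Num.sqrt `|hsq h P2|.
pose n := Num.sqrt (normsq c).
have r10 : 0 < r1 by rewrite sqrtr_gt0 normr_gt0.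
have r20 : 0 < r2 by rewrite sqrtr_gt0 normr_gt0.
have n0 : 0 < n by rewrite sqrtr_gt0 normsq_gt0.
have nE : n ^+ 2 = normsq c by rewrite sqr_sqrtr ?normsq_ge0.
have h1E : hsq h P1 = psign p1 * r1 ^+ 2 by rewrite sqr_sqrtr // -numEsg.
have h2E : hsq h P2 = psign p2 * r2 ^+ 2 by rewrite sqr_sqrtr // -numEsg.
pose u1 := (r1^-1)%:C *: P1.
pose u2 := (psign p2 / (n * r2))%:C *: (c *: P2).
pose g := n / (r1 * r2).
have g0 : 0 < g by rewrite divr_gt0 // mulr_gt0.
have hu1 : hsq h u1 = psign p1.
  by rewrite hsqZ normsq_real h1E; field; rewrite gt_eqF.
have hu2 : hsq h u2 = psign p2.
  rewrite !hsqZ normsq_real h2E -nE.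
  transitivity (psign p2 ^+ 2 * psign p2); last by rewrite s2E mul1r.
  by field; rewrite !gt_eqF.
have hu12 : h u1 u2 = (psign p2 * g)%:C.
  rewrite !hE -/(herm h p1 p2) -/c [_ * c]mulrC mul_conj_normsq -nE -!rmorphM.
  by congr _%:C; rewrite /g; field; rewrite !gt_eqF.
have gE : ptance p1 p2 = psign p1 * psign p2 * g ^+ 2.
  rewrite /ptance /tance -/(herm h p1 p2) -/c h1E h2E -nE /g.
  by case: (sign_cases s1E) (sign_cases s2E) => -> [] ->; field; rewrite !gt_eqF.
have g2 : 0 < g ^+ 2 - psign p1 * psign p2.
  have g20 : 0 < g ^+ 2 by rewrite exprn_gt0.
  rewrite -(pmulr_rgt0 _ g20); move: hyper; rewrite gE; congr (_ < _).
  by case: (sign_cases s1E) (sign_cases s2E) => -> [] ->; ring.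
have [v1 [v2 [t [x1 [x2 [y1 [y2 [pair [t0 t1] [e1 e2] [w1 w2]]]]]]]]] :=
  frame_of_gram s1E s2E hu1 hu2 hu12 g0 g2.
have tE : expR (ln t) = t by rewrite lnK.
have geo v x y : v != 0 -> v = x%:C *: u1 + y%:C *: u2 -> geodesic h p1 p2 <[v]>%VS.
  move=> v0 vE; exists v => //; split; last by apply/eqP.
  by rewrite vE /u1 /u2 (scalerA x%:C) (scalerA y%:C) -!rmorphM; exact: real_span2.
case: (pair) => v11 v22 v12; exists v1, v2, (ln t); split=> //.
- by split; [exact: pair1_neq0 pair | | exact: geo (pair1_neq0 pair) w1].
- by split; [exact: pair2_neq0 pair | | exact: geo (pair2_neq0 pair) w2].
- by apply: contraNneq t1 => l0; rewrite -tE l0 expR0.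
rewrite !sigma_intr expRN tE; split.
  rewrite {1}E1 -(line_eqZ (k := (r1^-1)%:C)) ?fmorph_eq0 ?invr_eq0 ?gt_eqF //.
  by rewrite -/u1 e1 /frame_point invr1 mulr1 scale1r.
rewrite {1}E2 -(line_eqZ P2 c0) -(line_eqZ (k := (psign p2 / (n * r2))%:C)).
  by rewrite -/u2 e2 /frame_point rmorphM.
by rewrite fmorph_eq0 mulf_neq0 ?psign_neq0 // invr_eq0 mulf_neq0 // gt_eqF.
Qed.

Lemma bending_exists p1 p2 v1 v2 a : is_point p1 -> is_point p2 ->
  ~~ isotropic h p1 -> ~~ isotropic h p2 -> ~~ orthogonal_points h p1 p2 ->
  bending_frame h p1 p2 v1 v2 a -> exists2 B, is_bending h p1 p2 B &
    forall s e x, x != 0 ->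
      B s (frame_point v1 v2 e x) = frame_point v1 v2 e (x * expR (a * s)).
Proof.
move=> pt1 pt2 n1 n2 o12 frame.
have [pair a0 E1 E2] := bending_frame_points frame.
have k0 s : expR (a * s) != 0 by rewrite gt_eqF // expR_gt0.
have sum : (p1 + p2)%VS = (<[v1]> + <[v2]>)%VS.
  have t0 : expR a != 0 by rewrite gt_eqF // expR_gt0.
  rewrite E1 E2; apply: (frame_point_span v1 v2 (oner_neq0 _) t0).
  rewrite divr1 mulr1 (_ : _ - _ = psign p2 / expR a * (expR a ^+ 2 - psign p1 * psign p2)).
    have d0 := frame_distinct a0 (psign_sqr n1) (psign_sqr n2).
    exact: mulf_neq0 (mulf_neq0 (psign_neq0 n2) (invr_neq0 t0)) d0.
  by case: (sign_cases (psign_sqr n2)) => ->; field.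
exists (fun s => linfun (bendop h v1 v2 (expR (a * s)))); last first.
  by move=> s e x x0; rewrite lfunE /= (bendop_frame_point pair).
split.
- split=> //; last by rewrite sum; exact: pair_signature.
  apply/eqP => p12; have := pair_dim pair.
  by rewrite -sum p12 addvv pt2.
- split.
    by apply/lfunP => u; rewrite lfunE /= mulr0 expR0 bendop1 id_lfunE.
  move=> s t; apply/lfunP => u; rewrite comp_lfunE !lfunE /= (bendop_comp pair) //.
  by rewrite mulrDr expRD.
- move=> s; split; last exact: bendop_det.
  by move=> u v; rewrite !lfunE /= (bendop_isometry pair).
exists v1, v2, a; split=> // s; split.
- by rewrite lfunE /= (bendop_v1 pair) mulNr expRN.
- by rewrite lfunE /= (bendop_v2 pair).
move=> u /mem_orthovP orth; rewrite lfunE /= bendop_orth //; apply: orth.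
  by rewrite memvE addvSl.
by rewrite memvE addvSr.
Qed.

End Existence.

(** * Reaching every point of the conic by one bending *)

Section Transitivity.
Variables (R : realType) (V : vectType R[i]).
Variable h : {hermitian_sym V for Num.conj}.
Hypothesis dimV : \dim {:V} = 3%N.
Hypothesis sigV : has_signature h {:V}%VS [:: 1; 1; -1].
Implicit Types (u v w : V) (s t x y k e : R) (p q : {vspace V}).
Local Notation psign := (psign h).
Local Notation ptance := (ptance h).
Local Notation peta := (peta h).
Local Notation pgram := (pgram h).

(** This is the square of the component of u orthogonal to v1 and v2, hence to the
negative vector v1 - v2. *)
Lemma pair_complement v1 v2 u : isotropic_pair h v1 v2 ->
  0 <= hsq h u - 4 * complex.Re (h u v1 * Num.conj (h u v2)).
Proof.
move=> pair; pose n := pair_orth h v1 v2 u.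
have n1 : h n v1 = 0 := pair_orth1 pair u.
have n2 : h n v2 = 0 := pair_orth2 pair u.
have -> : hsq h u - 4 * complex.Re (h u v1 * Num.conj (h u v2)) = hsq h n.
  apply: complexI; rewrite -hsqE {2}/n /pair_orth !hDr !hZr n1 n2 !mulr0 !addr0.
  rewrite /n /pair_orth !hE !hsqE -!(herm_conj h u) [h v1 u]herm_conj [h v2 u]herm_conj.
  rewrite rmorphB; case: (h u v1) (h u v2) => a b [c d].
  by apply/eqP; rewrite eq_complex /=; apply/andP; split; apply/eqP; ring.
have [->|n0] := eqVneq n 0; first by rewrite /hsq linear0l.
have vn : hsq h (frame_point v1 v2 (-1) 1) < 0.
  by rewrite (hsq_frame_point pair) ?oner_eq0 // oppr_lt0 ltr01.
apply/ltW/(orth_negative sigV vn _ n0).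
by rewrite /frame_point hDr !hZr n1 n2 !mulr0 addr0.
Qed.

(** The condition on y is the sign that |g23|^2 / (g22 g33) necessarily has. *)
Lemma bend12_reach p1 p2 p3 y e : strongly_regular h p1 p2 p3 ->
  0 < psign p2 * psign p3 * y ->
  on_surface (alpha h p1 p2 p3) (pgram p1 p2 p3) (ptance p1 p2) y e ->
  exists q1 q2, [/\ bend12 h (p1, p2, p3) (q1, q2, p3),
    ptance q2 p3 = y & complex.Re (peta q1 q2 p3) = e].
Proof.
move=> sr yp surf; have hyper := ptance_hyperbolic dimV sigV sr.
move: sr => /(strongly_regularP h dimV) [[pt1 pt2 pt3] [n1 n2 n3] [nz21 nz23] cnt [full al0]].
have nz12 : ~~ orthogonal_points h p1 p2 by rewrite orthogonal_sym.
have [v1 [v2 [a frame]]] := bending_frame_exists pt1 pt2 n1 n2 nz12 hyper.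
have [B bend BE] := bending_exists dimV pt1 pt2 n1 n2 nz12 frame.
have [pair a0 E1 E2] := bending_frame_points frame.
set t := expR a in E2; have t0 : t != 0 by rewrite gt_eqF // expR_gt0.
have [u0 E3] := point_rep pt3; set u := rep p3 in u0 E3.
have G0 : hsq h u != 0 by exact: hsq_rep_neq0.
have s1E := psign_sqr n1; have s2E := psign_sqr n2.
have s10 := psign_neq0 n1; have s20 := psign_neq0 n2.
have hn c x : c != 0 -> x != 0 -> frame_point v1 v2 c x != 0.
  by move=> c0 x0; exact: (frame_point_neq0 pair c0 x0).
pose A := normsq (h u v2); pose B' := normsq (h u v1).
pose K := complex.Re (h u v1 * Num.conj (h u v2)).
pose M := complex.Im (h u v1 * Num.conj (h u v2)).
have := frame_invariants pair s1E s2E t0 (oner_neq0 R) G0.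
rewrite mulr1 !expr1n !mul1r divr1 -/A -/B' -/K -/M.
move=> [j1 j2 j3 j4 j5].
have x12 : ptance p1 p2 = frame_tance12 (psign p1) (psign p2) t.
  by rewrite -j1 {1}E1 {1}E2 ptance_lineE ?hn ?oner_eq0.
have alE : alpha h p1 p2 p3 = frame_alpha (psign p1) (psign p2) t (hsq h u) M.
  by rewrite -j5 alphaE {1}E1 {1}E2 {1}E3 peta_lineE ?hn ?oner_eq0.
have prE : pgram p1 p2 p3 =
    (1 - frame_tance12 (psign p1) (psign p2) t) * (hsq h u - 4 * K) / hsq h u.
  rewrite -(gram_detE A B' K s1E s2E t0 G0) -j1 -j2 -j3 -j4.
  by rewrite /pgram {1 2 3}E1 {1 2 3}E2 {1 2 3}E3 !ptance_lineE ?peta_lineE ?hn ?oner_eq0.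
have AB : A * B' = K ^+ 2 + M ^+ 2.
  by rewrite /A /B' -[normsq (h u v2)]normsq_conj mulrC -normsqM.
(* If u is orthogonal to v1 or v2, then alpha = 0, so p3 is negative, against
   [pair_complement]. *)
have ab0 : h u v1 * Num.conj (h u v2) != 0.
  apply/negP => /eqP ab; have K0 : K = 0 by rewrite /K ab.
  have M0 : M = 0 by rewrite /M ab.
  have al00 : alpha h p1 p2 p3 = 0 by rewrite alE M0 /frame_alpha !mulr0 mul0r.
  have [_ _] := al0 al00; rewrite /negative herm_hsq ltcR ltNge => /negP; apply.
  by have := pair_complement u pair; rewrite -/K K0 mulr0 subr0.
have [A0 B0] : 0 < A /\ 0 < B'.
  move: ab0; rewrite mulf_eq0 conjC_eq0 negb_or => /andP [b0 aa0].
  by rewrite /A /B' !normsq_gt0.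
have yG : 0 < psign p2 * hsq h u * y.
  rewrite [hsq h u]numEsg -/(psign p3) mulrA mulrAC.
  by rewrite mulr_gt0 // normr_gt0.
have c0 := frame_nonorthogonal pair n1 n2 t0 nz12 E1 E2.
have d0 := frame_distinct a0 s1E s2E.
rewrite alE prE x12 in surf.
have [l l0 [yE eE]] := bending_solve s1E s2E t0 G0 c0 d0 A0 B0 AB yG surf.
pose k := Num.sqrt l; have k0 : 0 < k by rewrite sqrtr_gt0.
have kE : k ^+ 2 = l by rewrite sqr_sqrtr // ltW.
have kn0 : k != 0 by rewrite gt_eqF.
(* B s multiplies the parameter by e^(a s) = k, and [bending_solve] asks for k^2 = l. *)
pose s := ln k / a.
have sE : expR (a * s) = k by rewrite /s mulrC divfK // lnK.
have F1 : (B s @: p1)%VS = <[frame_point v1 v2 (psign p1) k]>%VS.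
  by rewrite {1}E1 limg_line BE ?oner_eq0 // mul1r sE.
have F2 : (B s @: p2)%VS = <[frame_point v1 v2 (psign p2) (t * k)]>%VS.
  by rewrite {1}E2 limg_line BE // sE.
exists (B s @: p1)%VS, (B s @: p2)%VS.
have [_ i2 _ i4 _] := frame_invariants pair s1E s2E t0 kn0 G0.
have tk0 : t * k != 0 by rewrite mulf_neq0.
split; first by exists B, s.
  by rewrite F2 E3 ptance_lineE ?hn // i2 kE.
by rewrite F1 F2 E3 peta_lineE ?hn // i4 kE.
Qed.

End Transitivity.

(** * Reversing a triple *)

Section Reversal.
Variables (R : realType) (V : vectType R[i]).
Variable h : {hermitian_sym V for Num.conj}.
Hypothesis dimV : \dim {:V} = 3%N.
Implicit Types (p q : {vspace V}).

Lemma peta_rev p1 p2 p3 : peta h p3 p2 p1 = Num.conj (peta h p1 p2 p3).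
Proof. exact: eta_rev. Qed.

Lemma alpha_rev p1 p2 p3 : alpha h p3 p2 p1 = - alpha h p1 p2 p3.
Proof. by rewrite !alphaE peta_rev; case: (peta h p1 p2 p3). Qed.

Lemma Re_peta_rev p1 p2 p3 :
  complex.Re (peta h p3 p2 p1) = complex.Re (peta h p1 p2 p3).
Proof. by rewrite peta_rev; case: (peta h p1 p2 p3). Qed.

Lemma pgram_rev p1 p2 p3 : pgram h p3 p2 p1 = pgram h p1 p2 p3.
Proof.
rewrite /pgram Re_peta_rev (ptanceC h p3 p2) (ptanceC h p2 p1) (ptanceC h p1 p3).
by rewrite /gram_det; ring.
Qed.

Lemma strongly_regular_rev p1 p2 p3 :
  strongly_regular h p1 p2 p3 -> strongly_regular h p3 p2 p1.
Proof.
move=> /(strongly_regularP h dimV) [[pt1 pt2 pt3] [n1 n2 n3] [nz21 nz23] cnt [full al]].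
apply/(strongly_regularP h dimV); split=> //.
  by move: cnt; rewrite /=; do 3!case: (positive h _).
split; first by rewrite addvC [(p3 + p2)%VS]addvC addvA.
by rewrite alpha_rev => /eqP; rewrite oppr_eq0 => /eqP /al [].
Qed.

Lemma geodesic_sub p1 p2 q : ~~ orthogonal_points h p1 p2 ->
  geodesic h p1 p2 q -> geodesic h p2 p1 q.
Proof.
move=> nz [w [[x wE] w0] <-].
have c0 : herm h p2 p1 != 0 by rewrite -/(orthogonal_points h p2 p1) orthogonal_sym.
rewrite /geodesic; exists (herm h p2 p1 *: w); last exact: line_eqZ.
split; last by move=> /eqP; rewrite scaler_eq0 (negPf c0) => /eqP.
rewrite wE !big_ord_recl big_ord0 addr0 /=.
exists (fun i : 'I_2 => nth 0 [:: x (lift ord0 ord0) * normsq (herm h p1 p2); x ord0] i).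
rewrite !big_ord_recl big_ord0 addr0 /= scalerDr !scalerA addrC.
congr (_ *: _ + _ *: _); last by rewrite mulrC.
rewrite rmorphM /= -mul_conj_normsq -/(herm h p1 p2) /herm [h (rep p2) _]herm_conj.
by ring.
Qed.

(** If v1, v2, a is a frame for p1, p2, then e^-a v1, e^a v2, -a is one for p2, p1. *)
Lemma is_bending_rev p1 p2 B : is_bending h p1 p2 B ->
  is_bending h p2 p1 (fun s => B (- s)).
Proof.
move=> [[[pt1 pt2] n12 nz12 [n1 n2] sg] [B0 BD] su [v1 [v2 [a [fr BE]]]]].
have nz21 : ~~ orthogonal_points h p2 p1 by rewrite orthogonal_sym.
split.
- by split=> //; rewrite 1?eq_sym // addvC.
- by split; [rewrite oppr0 | move=> s t; rewrite opprD BD].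
- by move=> s; exact: su.
have e0 : (expR a)%:C != 0 :> R[i] by rewrite fmorph_eq0 gt_eqF // expR_gt0.
have f0 : (expR (- a))%:C != 0 :> R[i] by rewrite fmorph_eq0 gt_eqF // expR_gt0.
have ef : (expR a)%:C * (expR (- a))%:C = 1 :> R[i].
  by rewrite -rmorphM expRN divff // gt_eqF // expR_gt0.
have fe : (expR (- a))%:C * (expR a)%:C = 1 :> R[i] by rewrite mulrC.
case: fr => [[v10 v11 g1] [v20 v22 g2] v12 a0 [E1 E2]].
exists ((expR (- a))%:C *: v1), ((expR a)%:C *: v2), (- a); split.
  split.
  - split; first by rewrite scaler_eq0 negb_or f0.
      by rewrite !hE v11 !mulr0.
    by rewrite line_eqZ //; exact: geodesic_sub.
  - split; first by rewrite scaler_eq0 negb_or e0.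
      by rewrite !hE v22 !mulr0.
    by rewrite line_eqZ //; exact: geodesic_sub.
  - by rewrite !hE v12 mulrCA mulrA ef mul1r.
  - by rewrite oppr_eq0.
  - split; first by rewrite {1}E2 scalerA.
    by rewrite opprK !scalerA ef -mulrA fe scale1r mulr1 -E1.
move=> s; have [b1 b2 b3] := BE (- s); split.
- by rewrite linearZ /= b1 !scalerA mulrC mulrNN opprK.
- by rewrite linearZ /= b2 !scalerA mulrC mulrN mulNr.
- by move=> u; rewrite !line_eqZ //; exact: b3.
Qed.

Lemma bend23_rev p1 p2 p3 q1 q2 q3 :
  bend23 h (p1, p2, p3) (q1, q2, q3) <-> bend12 h (p3, p2, p1) (q3, q2, q1).
Proof.
split=> [] [B [s [/is_bending_rev bd [-> -> ->]]]];
by exists (fun s => B (- s)), (- s); split=> //; rewrite opprK.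
Qed.

End Reversal.

(** * Triples with the same invariants are congruent *)

Section Congruence.
Variables (R : realType) (V : vectType R[i]).
Variable h : {hermitian_sym V for Num.conj}.
Implicit Types (u v w : V) (p q : {vspace V}).

Definition basis_map (e f : (\dim {:V}).-tuple V) u : V :=
  \sum_i coord e i u *: f`_i.

Lemma basis_map_linear e f : linear (basis_map e f).
Proof.
move=> c u v; rewrite /basis_map scaler_sumr -big_split; apply: eq_bigr => i _ /=.
by rewrite linearP scalerDl scalerA.
Qed.
HB.instance Definition _ e f :=
  GRing.isSemilinear.Build R[i] V V _ (basis_map e f)
    (GRing.semilinear_linear (basis_map_linear e f)).

(** The form is determined by its values on a basis. *)
Lemma gram_isometry (e f : (\dim {:V}).-tuple V) : basis_of {:V} e ->
  (forall i j : 'I_(\dim {:V}), h f`_i f`_j = h e`_i e`_j) ->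
  exists2 g : 'End(V), unitary h g & forall i : 'I_(\dim {:V}), g e`_i = f`_i.
Proof.
move=> bas gram; exists (linfun (basis_map e f)); last first.
  move=> i; rewrite lfunE /= /basis_map (bigD1 i) //= coord_free ?(basis_free bas) //.
  rewrite eqxx scale1r big1 ?addr0 // => j /negPf ji.
  by rewrite coord_free ?(basis_free bas) // eq_sym ji scale0r.
have gE u : linfun (basis_map e f) u = \sum_i coord e i u *: f`_i by rewrite lfunE.
move=> u v; rewrite !gE [in RHS](coord_basis bas (memvf u)).
rewrite [in RHS](coord_basis bas (memvf v)) !h_suml.
apply: eq_bigr => i _; rewrite !h_sumr; apply: eq_bigr => j _.
by rewrite !hZl !hZr gram.
Qed.

Lemma psign_sigma p : psign h p = (sigma h p)%:~R.
Proof. by rewrite sigmaE /psign sgz_sgr sgrEz. Qed.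

Hypothesis dimV : \dim {:V} = 3%N.
Local Notation psign := (psign h).
Local Notation ptance := (ptance h).

(** Once the representative of q' has been fixed, the product with q' determines the
factor for p'; its modulus then is right because tances and signs agree. *)
Lemma scaled_rep p p' q q' (c : R[i]) :
  ~~ isotropic h p -> ~~ isotropic h p' -> ~~ isotropic h q ->
  ~~ isotropic h q' -> ~~ orthogonal_points h p q -> ~~ orthogonal_points h p' q' ->
  psign p' = psign p -> ptance p' q' = ptance p q ->
  normsq c * hsq h (rep q') = hsq h (rep q) ->
  exists2 d : R[i], d != 0 &
    h (d *: rep p') (c *: rep q') = h (rep p) (rep q) /\
    hsq h (d *: rep p') = hsq h (rep p).
Proof.
move=> n1 n1' n2 n2' nz nz' sg T cE.
have H1 := hsq_rep_neq0 n1; have H1' := hsq_rep_neq0 n1'.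
have H2 := hsq_rep_neq0 n2; have H2' := hsq_rep_neq0 n2'.
have c0 : Num.conj c != 0.
  rewrite conjC_eq0; apply: contraNneq H2 => c0.
  by rewrite -cE c0 /normsq /= expr0n addr0 mul0r.
have c1 : normsq c != 0 by rewrite -normsq_conj normsq_eq0.
have nz1 : h (rep p) (rep q) != 0 by [].
have nz1' : h (rep p') (rep q') != 0 by [].
exists (h (rep p) (rep q) / (Num.conj c * h (rep p') (rep q'))).
  by rewrite mulf_neq0 // invr_eq0 mulf_neq0.
split; first by rewrite hZl hZr divfK // mulf_neq0.
rewrite hsqZ normsqM.
have normsqV z : normsq (z^-1) = (normsq z)^-1 :> R.
  have [->|z0] := eqVneq z 0; first by rewrite invr0 /normsq /= expr0n addr0 invr0.
  apply: (mulfI (_ : normsq z != 0)); first by rewrite normsq_eq0.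
  by rewrite divff ?normsq_eq0 // -normsqM divff // /normsq /= expr1n expr0n addr0.
rewrite normsqV normsqM normsq_conj.
have N0 : normsq (h (rep p') (rep q')) != 0 by rewrite normsq_eq0.
move: T; rewrite /ptance /tance => /(canRL (divfK _)) => T.
have {}T : normsq (h (rep p') (rep q')) =
    normsq (h (rep p) (rep q)) / (hsq h (rep p) * hsq h (rep q)) *
    (hsq h (rep p') * hsq h (rep q')).
  by apply: T; rewrite mulf_neq0.
have M0 : normsq (h (rep p) (rep q)) != 0 by rewrite normsq_eq0.
rewrite T -cE; field.
by rewrite M0 H1 H1' H2' c1.
Qed.

(** Rescale the second triple from the middle outwards: first p2', then p1' and p3'
by [scaled_rep]. The last Gram entry agrees because eta does. *)
Lemma congruent_triples p1 p2 p3 p1' p2' p3' :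
  strongly_regular h p1 p2 p3 -> strongly_regular h p1' p2' p3' ->
  [/\ psign p1' = psign p1, psign p2' = psign p2 & psign p3' = psign p3] ->
  ptance p1' p2' = ptance p1 p2 -> ptance p2' p3' = ptance p2 p3 ->
  peta h p1' p2' p3' = peta h p1 p2 p3 ->
  exists2 g : 'End(V), unitary h g &
    [/\ p1 = (g @: p1')%VS, p2 = (g @: p2')%VS & p3 = (g @: p3')%VS].
Proof.
move=> /(strongly_regularP h dimV) [[pt1 pt2 pt3] [n1 n2 n3] [nz21 nz23] _ _].
move=> /(strongly_regularP h dimV) [[pt1' pt2' pt3'] [n1' n2' n3'] [nz21' nz23'] _ [full _]].
move=> [s1 s2 s3] T12 T23 Eeta.
have H1 := hsq_rep_neq0 n1; have H2 := hsq_rep_neq0 n2; have H3 := hsq_rep_neq0 n3.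
have H2' := hsq_rep_neq0 n2'.
have pos : 0 < hsq h (rep p2) / hsq h (rep p2').
  rewrite [hsq h (rep p2)]numEsg [hsq h (rep p2')]numEsg -/(psign p2) -/(psign p2') s2.
  rewrite -mulf_div divff ?psign_neq0 // mul1r divr_gt0 ?normr_gt0 //.
pose c : R[i] := (Num.sqrt (hsq h (rep p2) / hsq h (rep p2')))%:C.
have cE : normsq c * hsq h (rep p2') = hsq h (rep p2).
  by rewrite normsq_real sqr_sqrtr ?ltW // divfK.
have c0 : c != 0 by rewrite fmorph_eq0 sqrtr_eq0 -ltNge.
have nz12 : ~~ orthogonal_points h p1 p2 by rewrite orthogonal_sym.
have nz12' : ~~ orthogonal_points h p1' p2' by rewrite orthogonal_sym.
have nz32 : ~~ orthogonal_points h p3 p2 by rewrite orthogonal_sym.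
have nz32' : ~~ orthogonal_points h p3' p2' by rewrite orthogonal_sym.
have [d1 d10 [h12 h11]] := scaled_rep n1 n1' n2 n2' nz12 nz12' s1 T12 cE.
rewrite ptanceC [RHS]ptanceC in T23.
have [d3 d30 [h32 h33]] := scaled_rep n3 n3' n2 n2' nz32 nz32' s3 T23 cE.
have [P10 E1] := point_rep pt1; have [P20 E2] := point_rep pt2.
have [P30 E3] := point_rep pt3.
have [P10' E1'] := point_rep pt1'; have [P20' E2'] := point_rep pt2'.
have [P30' E3'] := point_rep pt3'.
set u1 := d1 *: rep p1' in h12 h11; set u2 := c *: rep p2' in h12 h32.
set u3 := d3 *: rep p3' in h32 h33.
have h22 : hsq h u2 = hsq h (rep p2) by rewrite hsqZ.
have L1 : p1' = <[u1]>%VS by rewrite line_eqZ.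
have L2 : p2' = <[u2]>%VS by rewrite line_eqZ.
have L3 : p3' = <[u3]>%VS by rewrite line_eqZ.
have h23 : h u2 u3 = h (rep p2) (rep p3) by rewrite herm_conj h32 -herm_conj.
have h21 : h u2 u1 = h (rep p2) (rep p1) by rewrite herm_conj h12 -herm_conj.
have h31 : h u3 u1 = h (rep p3) (rep p1).
  have := Eeta; rewrite {1}/peta -(etaZ h _ _ _ d10 c0 d30) -/u1 -/u2 -/u3.
  rewrite /peta /eta !hsqE h11 h22 h33 h12 h23.
  have D0 : ((hsq h (rep p1))%:C * (hsq h (rep p2))%:C * (hsq h (rep p3))%:C)^-1 != 0.
    by rewrite invr_eq0 !mulf_neq0 // fmorph_eq0.
  have N0 : h (rep p1) (rep p2) * h (rep p2) (rep p3) != 0 by rewrite mulf_neq0.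
  by move=> /(mulIf D0) /(mulfI N0).
have h13 : h u1 u3 = h (rep p1) (rep p3) by rewrite herm_conj h31 -herm_conj.
have sz : size [:: u1; u2; u3] == \dim {:V} by rewrite dimV.
have sz' : size [:: rep p1; rep p2; rep p3] == \dim {:V} by rewrite dimV.
have bas : basis_of {:V} (Tuple sz) by apply: full_basis; rewrite // -L1 -L2 -L3.
have [|g gU gE] := @gram_isometry (Tuple sz) (Tuple sz') bas.
  move=> i j; have := ltn_ord i; have := ltn_ord j; rewrite {2 4}dimV.
  case: i j => [[|[|[|i]]] ?] [[|[|[|j]]] ?] //= _ _; rewrite ?hsqE ?h11 ?h22 ?h33 //.
have [i0 i1 i2] : [/\ (0 < \dim {:V})%N, (1 < \dim {:V})%N & (2 < \dim {:V})%N].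
  by rewrite dimV.
exists g => //; split; rewrite ?L1 ?L2 ?L3 limg_line.
- by have /= -> := gE (Ordinal i0).
- by have /= -> := gE (Ordinal i1).
- by have /= -> := gE (Ordinal i2).
Qed.

End Congruence.

(** * Connecting two triples by bendings *)

Section Final.
Variables (R : realType) (V : vectType R[i]).
Variable h : {hermitian_sym V for Num.conj}.
Hypothesis dimV : \dim {:V} = 3%N.
Hypothesis sigV : has_signature h {:V}%VS [:: 1; 1; -1].
Implicit Types (p q : {vspace V}).
Local Notation psign := (psign h).
Local Notation ptance := (ptance h).

Lemma strongly_regular_bend23 p1 p2 p3 q1 q2 q3 :
  strongly_regular h p1 p2 p3 -> bend23 h (p1, p2, p3) (q1, q2, q3) ->
  strongly_regular h q1 q2 q3.
Proof.
move=> /(strongly_regular_rev dimV) sr /bend23_rev /(strongly_regular_bend12 dimV sigV sr).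
exact: strongly_regular_rev.
Qed.

Definition has_invariants (s1 s2 s3 a b : R) p1 p2 p3 : Prop :=
  [/\ strongly_regular h p1 p2 p3,
      [/\ psign p1 = s1, psign p2 = s2 & psign p3 = s3],
      alpha h p1 p2 p3 = a & pgram h p1 p2 p3 = b].

Lemma invariants_nonisotropic s1 s2 s3 a b p1 p2 p3 :
  has_invariants s1 s2 s3 a b p1 p2 p3 ->
  [/\ ~~ isotropic h p1, ~~ isotropic h p2 & ~~ isotropic h p3].
Proof. by case=> /(strongly_regularP h dimV) []. Qed.

Lemma invariants_rev s1 s2 s3 a b p1 p2 p3 :
  has_invariants s1 s2 s3 a b p1 p2 p3 ->
  has_invariants s3 s2 s1 (- a) b p3 p2 p1.
Proof.
move=> [sr [e1 e2 e3] ea eb]; split.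
- exact: strongly_regular_rev.
- by split.
- by rewrite alpha_rev ea.
- by rewrite pgram_rev.
Qed.

Lemma invariants_surface s1 s2 s3 a b p1 p2 p3 :
  has_invariants s1 s2 s3 a b p1 p2 p3 ->
  [/\ on_surface a b (ptance p1 p2) (ptance p2 p3) (complex.Re (peta h p1 p2 p3)),
      0 < ptance p1 p2 * (ptance p1 p2 - 1),
      0 < s1 * s2 * ptance p1 p2 & 0 < s2 * s3 * ptance p2 p3].
Proof.
move=> inv; have [n1 n2 n3] := invariants_nonisotropic inv.
case: inv => sr [<- <- <-] <- <-; split; first exact: gram_surface.
- exact: ptance_hyperbolic sr.
- apply: ptance_sign => //; rewrite orthogonal_sym.
  by case: sr => -[_ _ _ []].
- by apply: ptance_sign => //; case: sr => -[_ _ _ []].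
Qed.

Lemma bend12_deform s1 s2 s3 a b p1 p2 p3 y e :
  has_invariants s1 s2 s3 a b p1 p2 p3 ->
  0 < s2 * s3 * y -> on_surface a b (ptance p1 p2) y e ->
  exists q1 q2, [/\ bend12 h (p1, p2, p3) (q1, q2, p3),
    has_invariants s1 s2 s3 a b q1 q2 p3, ptance q1 q2 = ptance p1 p2,
    ptance q2 p3 = y & complex.Re (peta h q1 q2 p3) = e].
Proof.
move=> inv yp surf; have [n1 n2 n3] := invariants_nonisotropic inv.
case: inv => sr [e1 e2 e3] al pr.
have [q1 [q2 [bd yE eE]]] : exists q1 q2, [/\ bend12 h (p1, p2, p3) (q1, q2, p3),
    ptance q2 p3 = y & complex.Re (peta h q1 q2 p3) = e].
  by apply: (bend12_reach dimV sigV sr); rewrite ?e2 ?e3 ?al ?pr.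
have pt3 : is_point p3 by case: sr => -[[]].
have [_ _ [f1 f2] [xE aE bE] _] := bend12_invariants pt3 n1 n2 n3 bd.
exists q1, q2; split=> //; split; [|by rewrite f1 f2|by rewrite aE|by rewrite bE].
exact: (strongly_regular_bend12 dimV sigV sr bd).
Qed.

Lemma bend23_deform s1 s2 s3 a b p1 p2 p3 x e :
  has_invariants s1 s2 s3 a b p1 p2 p3 ->
  0 < s1 * s2 * x -> on_surface a b x (ptance p2 p3) e ->
  exists q2 q3, [/\ bend23 h (p1, p2, p3) (p1, q2, q3),
    has_invariants s1 s2 s3 a b p1 q2 q3, ptance q2 q3 = ptance p2 p3,
    ptance p1 q2 = x & complex.Re (peta h p1 q2 q3) = e].
Proof.
move=> /invariants_rev inv xp surf.
have yp : 0 < s2 * s1 * x by rewrite [s2 * _]mulrC.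
have : on_surface (- a) b (ptance p3 p2) x e.
  by rewrite ptanceC; apply: surfaceN; apply: surface_sym.
move=> /(bend12_deform inv yp) [q3 [q2 [bd qinv yE xE eE]]].
exists q2, q3; split.
- exact/bend23_rev.
- by rewrite -[a]opprK; apply: invariants_rev.
- by rewrite ptanceC yE ptanceC.
- by rewrite ptanceC.
- by rewrite Re_peta_rev.
Qed.

Lemma common_ray (y y' : R) : 0 < y * y' ->
  exists k k' : R, [/\ 1 <= k, 1 <= k' & k * y = k' * y'].
Proof.
move=> yy; have y0 : y != 0 by apply: contraTneq yy => ->; rewrite mul0r ltxx.
have y'0 : y' != 0 by apply: contraTneq yy => ->; rewrite mulr0 ltxx.
have r0 : 0 < y' / y.
  rewrite (_ : y' / y = y * y' / y ^+ 2); last by field.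
  by rewrite divr_gt0 // exprn_even_gt0.
have [le|lt] := leP 1 (y' / y).
  by exists (y' / y), 1; rewrite divfK // mul1r; split.
exists 1, (y / y'); rewrite divfK // mul1r; split=> //.
by rewrite -[y / y']invrK invf_div invf_ge1 // ltW.
Qed.

(** Three bendings: up the conic x = const to a level Y, across along the conic
y = Y, and down the conic over x'. *)
Lemma bendings_connect s1 s2 s3 a b p1 p2 p3 p1' p2' p3' :
  has_invariants s1 s2 s3 a b p1 p2 p3 ->
  has_invariants s1 s2 s3 a b p1' p2' p3' ->
  exists q1 q2 q3, [/\ bendings h (p1, p2, p3) (q1, q2, q3),
    has_invariants s1 s2 s3 a b q1 q2 q3, ptance q1 q2 = ptance p1' p2',
    ptance q2 q3 = ptance p2' p3' &
    complex.Re (peta h q1 q2 q3) = complex.Re (peta h p1' p2' p3')].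
Proof.
move=> inv inv'; have [sf hx sx sy] := invariants_surface inv.
have [sf' hx' sx' sy'] := invariants_surface inv'.
set x := ptance p1 p2 in sf hx sx *; set y := ptance p2 p3 in sf sy *.
set x' := ptance p1' p2' in sf' hx' sx' *; set y' := ptance p2' p3' in sf' sy' *.
have yy : 0 < y * y'.
  have := mulr_gt0 sy sy'; rewrite mulrACA.
  by rewrite pmulr_rgt0 // lt_def mulf_neq0 ?sqr_ge0 //;
   apply: contraTneq sy => ->; rewrite mul0r ltxx.
have [k [k' [k1 k'1 ky]]] := common_ray yy.
have Yp : 0 < s2 * s3 * (k * y) by rewrite mulrCA mulr_gt0 // (lt_le_trans ltr01).
have [e1 S1] := surface_exists (surface_ray hx k1 (surface_le sf)).
have [e2] := surface_exists (surface_ray hx' k'1 (surface_le sf')).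
rewrite -ky => S2.
have [q1 [q2 [b1 inv1 x1 y1 _]]] := bend12_deform inv Yp S1.
rewrite -y1 in S2.
have [r2 [r3 [b2 inv2 y2 x2 _]]] := bend23_deform inv1 sx' S2.
rewrite -x2 in sf'.
have [t1 [t2 [b3 inv3 x3 y3 e3]]] := bend12_deform inv2 sy' sf'.
exists t1, t2, r3; split=> //; last by rewrite x3.
apply: rt_trans (rt_step _ _ _ _ (or_introl b1)) _.
apply: rt_trans (rt_step _ _ _ _ (or_intror b2)) _.
exact: rt_step (or_introl b3).
Qed.

End Final.

Theorem corollary4p1p5 (R : realType) (V : vectType R[i])
    (h : {hermitian_sym V for Num.conj})
    (dimV : \dim {:V} = 3%N)
    (sigV : has_signature h {:V}%VS [:: 1; 1; -1]) :
  (forall p1 p2 p3 q1 q2 q3 : {vspace V},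
      strongly_regular h p1 p2 p3 ->
      bend12 h (p1, p2, p3) (q1, q2, q3) \/ bend23 h (p1, p2, p3) (q1, q2, q3) ->
      strongly_regular h q1 q2 q3)
  /\
  (forall (a b : R) (s1 s2 s3 : int),
      s1 \in [:: -1; 1] -> s2 \in [:: -1; 1] -> s3 \in [:: -1; 1] ->
    forall p1 p2 p3 p1' p2' p3' : {vspace V},
      strongly_regular h p1 p2 p3 -> strongly_regular h p1' p2' p3' ->
      [/\ sigma h p1 = s1, sigma h p2 = s2 & sigma h p3 = s3] ->
      [/\ sigma h p1' = s1, sigma h p2' = s2 & sigma h p3' = s3] ->
      alpha h p1 p2 p3 = a -> alpha h p1' p2' p3' = a ->
      beta h p1 p2 p3 = b%:C -> beta h p1' p2' p3' = b%:C ->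
    exists g : {vspace V} -> {vspace V},
      projective_unitary h g /\
      bendings h (p1, p2, p3) (g p1', g p2', g p3')).
Proof.
split=> [p1 p2 p3 q1 q2 q3 sr [b12|b23]|].
- exact: (strongly_regular_bend12 dimV sigV sr b12).
- exact: (strongly_regular_bend23 dimV sigV sr b23).
move=> a b s1 s2 s3 _ _ _ p1 p2 p3 p1' p2' p3' sr sr' sg sg' al al' be be'.
have invI q1 q2 q3 : strongly_regular h q1 q2 q3 ->
    [/\ sigma h q1 = s1, sigma h q2 = s2 & sigma h q3 = s3] ->
    alpha h q1 q2 q3 = a -> beta h q1 q2 q3 = b%:C ->
    has_invariants h s1%:~R s2%:~R s3%:~R a b q1 q2 q3.
  move=> srq [<- <- <-] alq.
  have [_ [n1 n2 n3] _ _ _] := (strongly_regularP h dimV q1 q2 q3).1 srq.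
  by rewrite beta_pgram // => /complexI; split; rewrite // !psign_sigma.
have inv' := invI _ _ _ sr' sg' al' be'.
have [q1 [q2 [q3 [bd invq x y e]]]] :=
  bendings_connect dimV sigV (invI _ _ _ sr sg al be) inv'.
have [srq [e1 e2 e3] alq _] := invq; have [_ [e1' e2' e3'] _ _] := inv'.
have Eeta : peta h p1' p2' p3' = peta h q1 q2 q3.
  by apply/eqP; rewrite eq_complex e -!alphaE alq al' !eqxx.
have sgn : [/\ psign h p1' = psign h q1, psign h p2' = psign h q2 &
               psign h p3' = psign h q3] by rewrite e1 e2 e3.
have [f fU [E1 E2 E3]] :=
  congruent_triples dimV srq sr' sgn (esym x) (esym y) Eeta.
exists (fun p => (f @: p)%VS); split; first by exists f.
by rewrite -E1 -E2 -E3.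
Qed.
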